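(* Let $\Omega\subset\mathbb{R}^n$ be an open set with nonempty boundary. Let $f,g:\mathbb{R}\to\mathbb{R}$ be nondecreasing continuous functions such that $f(-t)<0<f(t)$ for all $t>0$, at least one of $f$, $g$ is strictly increasing, and $g(t)\ge 0$ for all $t>0$. For $0<q<2$ set $$h(s):=\left(\frac{f(s)}{s}\right)^{1/2}+\left(\frac{g(s)}{s^{1-q}}\right)^{1/(2-q)},\qquad s>0.$$ Let $\mathcal{O}$ be a connected open set that is compactly contained in $\Omega$. Consider the equation $$\Delta_\infty^N u=f(u)+g(u)|Du|^q\quad\text{in }\Omega.\qquad(\ast)$$ (1) Suppose $0<q<1$ and that there are constants $0<\varrho<1$ and $\nu>0$ such that $$\frac{h(s)}{s^\nu}\ge\varrho\,\frac{h(t)}{t^\nu}\qquad\text{for all }s\ge t>0.$$ Then there is a positive constant $C$, depending only on $q,\nu,\varrho,\mathcal{O}$ and $\operatorname{dist}(\mathcal{O},\partial\Omega)$, such that every nonnegative viscosity solution $u\in\mathcal{C}(\Omega)$ of $(\ast)$ satisfies $$\sup_{\mathcal{O}}u\le C\inf_{\mathcal{O}}u.$$ (2) Suppose $1\le q<2$, that there is a constant $0<\mu<1$ such that $$h(s)\ge\mu\,h(t)\qquad\text{for all }s\ge t>0,$$ that $$\int_1^\infty\frac{ds}{\sqrt{F(s)}+G(s)^{\frac1{2-q}}}<\infty,\qquad F(t):=\int_0^tf(s)\,ds,\quad G(t):=\int_0^tg(s)\,ds,$$ and, when $1<q<2$, that in addition $\lim_{t\to\infty}f(t)=\infty$ or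 $\lim_{t\to\infty}g(t)=\infty$. Then there is a positive constant $C$, depending only on $q,\mu,f,g,\mathcal{O}$ and $\operatorname{dist}(\mathcal{O},\partial\Omega)$, such that every nonnegative viscosity solution $u\in\mathcal{C}(\Omega)$ of $(\ast)$ satisfies $$\sup_{\mathcal{O}}u\le C\inf_{\mathcal{O}}u.$$
   Context: $\mathcal{C}(\Omega)$ is the class of continuous real-valued functions on $\Omega$, and $\operatorname{dist}(\mathcal{O},\partial\Omega)=\inf\{|x-y|:x\in\mathcal{O},\,y\in\partial\Omega\}$. The normalized infinity-Laplacian is formally $\Delta_\infty^N u=|Du|^{-2}\langle D^2u\,Du,Du\rangle$. For a function $\phi$ that is $C^2$ near $x$: if $D\phi(x)\ne0$, put $\Delta_\infty^{N,\pm}\phi(x):=|D\phi(x)|^{-2}\langle D^2\phi(x)D\phi(x),D\phi(x)\rangle$; if $D\phi(x)=0$, put $\Delta_\infty^{N,+}\phi(x):=\max\{\langle D^2\phi(x)e,e\rangle:|e|=1\}$ and $\Delta_\infty^{N,-}\phi(x):=\min\{\langle D^2\phi(x)e,e\rangle:|e|=1\}$. An upper-semicontinuous $u$ on $\Omega$ is a viscosity subsolution of $\Delta_\infty^Nu=H(x,u,Du)$ in $\Omega$ if, whenever $x_0\in\Omega$ and $\phi$ is $C^2$ near $x_0$ with $u-\phi$ having a local maximum at $x_0$, one has $\Delta_\infty^{N,+}\phi(x_0)\ge H(x_0,u(x_0),D\phi(x_0))$. A lower-semicontinuous $u$ is a viscosity supersolution if, whenever $u-\phi$ has a local minimum at $x_0$,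 one has $\Delta_\infty^{N,-}\phi(x_0)\le H(x_0,u(x_0),D\phi(x_0))$. A viscosity solution is a continuous function that is both a viscosity subsolution and a viscosity supersolution. Here $H(x,t,p)=f(t)+g(t)|p|^q$. *)

(* Defs.v *)
From mathcomp Require Export all_boot all_order all_algebra.
From mathcomp Require Export all_classical all_reals all_analysis.

Export Order.TTheory GRing.Theory Num.Theory.
Export numFieldNormedType.Exports.

Set Implicit Arguments.
Unset Strict Implicit.
Unset Printing Implicit Defensive.

Local Open Scope classical_set_scope.
Local Open Scope ring_scope.

(* The library norm `|x| on 'rV[R]_n is the sup norm, so the Euclidean inner
   product and norm are introduced here; the topologies agree. *)
Definition dotp (R : realType) (n : nat) (x y : 'rV[R]_n) : R :=
  \sum_(i < n) x 0 i * y 0 i.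

Definition enorm (R : realType) (n : nat) (x : 'rV[R]_n) : R :=
  Num.sqrt (dotp x x).

Definition boundary (T : topologicalType) (A : set T) : set T :=
  closure A `\` interior A.

Definition set_dist (R : realType) (n : nat) (A B : set 'rV[R]_n) : R :=
  inf [set enorm (x - y) | x in A & y in B].

Definition compactly_contained (T : topologicalType) (A B : set T) : Prop :=
  compact (closure A) /\ closure A `<=` B.

Definition partial (R : realType) (n : nat) (phi : 'rV[R]_n -> R) (i : 'I_n) :
  'rV[R]_n -> R := 'D_(delta_mx 0 i) phi.

Definition gradient (R : realType) (n : nat) (phi : 'rV[R]_n -> R)
  (x : 'rV[R]_n) : 'rV[R]_n := \row_i partial phi i x.

Definition hessian (R : realType) (n : nat) (phi : 'rV[R]_n -> R)
  (x : 'rV[R]_n) : 'M[R]_n := \matrix_(i, j) partial (partial phi j) i x.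

Definition C2_near (R : realType) (n : nat) (phi : 'rV[R]_n -> R)
    (x : 'rV[R]_n) : Prop :=
  \forall y \near x,
    [/\ {for y, continuous phi},
        forall i, derivable phi y (delta_mx 0 i) /\
                  {for y, continuous (partial phi i)} &
        forall i j, derivable (partial phi j) y (delta_mx 0 i) /\
                    {for y, continuous (partial (partial phi j) i)}].

(* <A e, e> for the row vector e, i.e. e A e^T up to the symmetry of A. *)
Definition quad_form (R : realType) (n : nat) (A : 'M[R]_n) (e : 'rV[R]_n) : R :=
  dotp (e *m A^T) e.

(* Where D phi(x) = 0 the sup (inf) is over the compact unit sphere, nonempty
   for n > 0, so it is the max (min). *)
Definition ninflap_upper (R : realType) (n : nat) (phi : 'rV[R]_n -> R)
    (x : 'rV[R]_n) : R :=
  if gradient phi x == 0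
  then sup [set quad_form (hessian phi x) e | e in [set e | enorm e = 1]]
  else enorm (gradient phi x) ^- 2 * quad_form (hessian phi x) (gradient phi x).

Definition ninflap_lower (R : realType) (n : nat) (phi : 'rV[R]_n -> R)
    (x : 'rV[R]_n) : R :=
  if gradient phi x == 0
  then inf [set quad_form (hessian phi x) e | e in [set e | enorm e = 1]]
  else enorm (gradient phi x) ^- 2 * quad_form (hessian phi x) (gradient phi x).

(* The subspace topology makes points outside Omega isolated, so these only
   constrain u on Omega. *)
Definition lsc_on (T : topologicalType) (R : realType) (Omega : set T)
    (u : T -> R) : Prop :=
  lower_semicontinuous (fun x : subspace Omega => (u x)%:E).

Definition usc_on (T : topologicalType) (R : realType) (Omega : set T)
    (u : T -> R) : Prop :=
  lsc_on Omega (fun x => - u x).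

Definition viscosity_subsolution (R : realType) (n : nat) (Omega : set 'rV[R]_n)
    (H : 'rV[R]_n -> R -> 'rV[R]_n -> R) (u : 'rV[R]_n -> R) : Prop :=
  usc_on Omega u /\
  forall (x0 : 'rV[R]_n) (phi : 'rV[R]_n -> R),
    Omega x0 -> C2_near phi x0 ->
    (\forall x \near x0, u x - phi x <= u x0 - phi x0) ->
    H x0 (u x0) (gradient phi x0) <= ninflap_upper phi x0.

Definition viscosity_supersolution (R : realType) (n : nat)
    (Omega : set 'rV[R]_n)
    (H : 'rV[R]_n -> R -> 'rV[R]_n -> R) (u : 'rV[R]_n -> R) : Prop :=
  lsc_on Omega u /\
  forall (x0 : 'rV[R]_n) (phi : 'rV[R]_n -> R),
    Omega x0 -> C2_near phi x0 ->
    (\forall x \near x0, u x0 - phi x0 <= u x - phi x) ->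
    ninflap_lower phi x0 <= H x0 (u x0) (gradient phi x0).

Definition viscosity_solution (R : realType) (n : nat) (Omega : set 'rV[R]_n)
    (H : 'rV[R]_n -> R -> 'rV[R]_n -> R) (u : 'rV[R]_n -> R) : Prop :=
  [/\ {within Omega, continuous u},
      viscosity_subsolution Omega H u &
      viscosity_supersolution Omega H u].

Definition rhs (R : realType) (n : nat) (q : R) (f g : R -> R) :
    'rV[R]_n -> R -> 'rV[R]_n -> R :=
  fun _ t p => f t + g t * enorm p `^ q.

Definition admissible (R : realType) (f g : R -> R) : Prop :=
  [/\ {homo f : x y / x <= y} /\ {homo g : x y / x <= y},
      continuous f /\ continuous g,
      forall t, 0 < t -> f (- t) < 0 < f t,
      {homo f : x y / x < y} \/ {homo g : x y / x < y} &
      forall t, 0 < t -> 0 <= g t].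

Definition hfun (R : realType) (q : R) (f g : R -> R) (s : R) : R :=
  (f s / s) `^ 2^-1 + (g s / s `^ (1 - q)) `^ (2 - q)^-1.

(* Agrees with the oriented integral from 0 to t only for 0 <= t, the range
   in which it is used. *)
Definition primitive (R : realType) (f : R -> R) (t : R) : R :=
  Rintegral lebesgue_measure `[0, t] f.

Definition integral_condition (R : realType) (q : R) (f g : R -> R) : Prop :=
  (\int[lebesgue_measure]_(s in `[1%R, +oo[)
     ((Num.sqrt (primitive f s) + primitive g s `^ (2 - q)^-1)^-1)%:E
   < +oo)%E.

(* Main.v *)
Require Import Defs.
From mathcomp Require Import measurable_realfun ring lra.

(** Write the equation as [u'' = f(u) + g(u) |u'|^q] along the gradient. By the
definition of [h], a bound [h(u) <= H] gives [f(u) <= H^2 u] and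
[g(u) |Du|^q <= H^(2-q) u^(1-q) |Du|^q]: the right-hand side is dominated by a
function of [(u, Du)] that is homogeneous of degree one, which is the setting of
a Harnack inequality. So there are two tasks: an a priori bound for [h(u)] away
from the boundary, in which only the subsolution property is used, and a local
Harnack inequality with constants depending on [H], in which only the
supersolution property is used.

Local inequality ([supersolution_local_harnack]). In a ball of radius [r] with
[H r] small, the parabola [u(y) (1 - |x - y| / r)^2] is a strict subsolution for
the values that matter, and comparison gives [u(y) <= 4 u(x)] for
[|x - y| <= r / 2]. Connectedness of [O] and compactness of its closure bound the
number of balls in a chain joining two points ([harnack_chain]).

A priori bound. Let [M(rho)] be the maximum of [u] over the ball of radius [rho]
around [y], and [t = u(y) = M(0)]. In the viscosity sense [M] is a
one-dimensional subsolution, [M'' >= f(M) + g(M) M'^q]; this is recorded as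
comparison with parabolas ([radial_growth], [ballmax_growth]). Integrating once,
an increase of [M] by [s] above a level [A] forces the slope to be at least a
multiple of [W = (f(A) s)^(1/2) + (g(A) s)^(1/(2-q))] ([crossing_time]). Hence [M]
passes from [t + 2s] to [t + 4s] within a distance of order [s / W], where
[A = t + s]. If these distances, summed over [s = s0 2^i], add up to less than
the radius of a ball contained in the domain, then [M] blows up inside it, which
is absurd ([subsolution_radius]). The integrated inequality is proved without
differentiating [M]: the slope halves over a distance controlled by one
comparison ([slope_halving]), and the resulting series is geometric because
[q < 2].

Part 1. Here [s / W] is at most a multiple of [(s / A)^((1-q)/(2-q)) / h(A)]. For
[s < t] the power is summable as [q < 1], and for [s > t] the hypothesis gives
[h(A) >= rho (A / t)^nu h(t)]; the total is a multiple of [1 / h(t)], so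
[r h(u(y))] is bounded by a constant depending on [q], [nu] and [rho] only
([subsolution_radius_power]).

Part 2. Here [W] is at least the denominator of the integral condition at [s],
so large [s] contribute the tail of a convergent dyadic sum; for [s] in a bounded
range each crossing time tends to zero as [t] grows, since [f] or [g] tends to
infinity. Thus [u(y)] is bounded by a constant ([subsolution_bound]), and almost
monotonicity of [h] bounds [h(u)]. For [q = 1] the integral condition itself
excludes that [f] and [g] are both bounded ([integral_condition_unbounded]). *)

Set Implicit Arguments.
Unset Strict Implicit.
Unset Printing Implicit Defensive.

Local Open Scope classical_set_scope.
Local Open Scope ring_scope.

(** * Euclidean norm and radial test functions *)

Lemma dotpC (R : realType) n (x y : 'rV[R]_n) : dotp x y = dotp y x.
Proof. by apply: eq_bigr => i _; rewrite mulrC. Qed.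

Lemma dotpZl (R : realType) n (k : R) (x y : 'rV[R]_n) :
  dotp (k *: x) y = k * dotp x y.
Proof. by rewrite /dotp mulr_sumr; apply: eq_bigr => i _; rewrite mxE mulrA. Qed.

Lemma dotpZr (R : realType) n (k : R) (x y : 'rV[R]_n) :
  dotp x (k *: y) = k * dotp x y.
Proof. by rewrite dotpC dotpZl dotpC. Qed.

Lemma dotpDl (R : realType) n (x y z : 'rV[R]_n) :
  dotp (x + y) z = dotp x z + dotp y z.
Proof. by rewrite /dotp -big_split; apply: eq_bigr => i _; rewrite mxE mulrDl. Qed.

Lemma dotp_sqrD (R : realType) n (x y : 'rV[R]_n) :
  dotp (x + y) (x + y) = dotp x x + 2 * dotp x y + dotp y y.
Proof.
by rewrite dotpDl (dotpC x) (dotpC y (x + y)) !dotpDl (dotpC y x); ring.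
Qed.

Lemma dotpp_ge0 (R : realType) n (x : 'rV[R]_n) : 0 <= dotp x x.
Proof. by apply: sumr_ge0 => i _; rewrite -expr2 sqr_ge0. Qed.

Lemma enorm_ge0 (R : realType) n (x : 'rV[R]_n) : 0 <= enorm x.
Proof. exact: sqrtr_ge0. Qed.

Lemma sqr_enorm (R : realType) n (x : 'rV[R]_n) : enorm x ^+ 2 = dotp x x.
Proof. by rewrite sqr_sqrtr ?dotpp_ge0. Qed.

Lemma enormZ (R : realType) n (k : R) (x : 'rV[R]_n) :
  enorm (k *: x) = `|k| * enorm x.
Proof.
by rewrite /enorm dotpZl dotpZr mulrA -expr2 sqrtrM ?sqr_ge0// sqrtr_sqr.
Qed.

Lemma enorm0 (R : realType) n : enorm (0 : 'rV[R]_n) = 0.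
Proof. by rewrite -(scale0r 0) enormZ normr0 mul0r. Qed.

Lemma enorm_eq0 (R : realType) n (x : 'rV[R]_n) : enorm x = 0 -> x = 0.
Proof.
move=> x0; have : dotp x x = 0 by rewrite -sqr_enorm x0 expr0n.
move=> /eqP; rewrite psumr_eq0; last by move=> i _; rewrite -expr2 sqr_ge0.
move=> /allP x00; apply/rowP => i; rewrite mxE.
by have := x00 i (mem_index_enum _); rewrite -expr2 sqrf_eq0 => /eqP.
Qed.

(** The two norms are equivalent; [normr_le_enorm] and [enorm_le_normr] let
topological facts stated for the sup norm be used with Euclidean balls. *)
Lemma normr_le_enorm (R : realType) n (x : 'rV[R]_n) : `|x| <= enorm x.
Proof.
rewrite [leLHS]/Num.norm /= mx_normrE; apply/bigmax_leP; split=> [|[i j] _ /=].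
  exact: enorm_ge0.
rewrite -ler_sqr ?nnegrE ?enorm_ge0// sqr_enorm real_normK ?num_real//.
rewrite (ord1 i) /dotp (bigD1 j) //= -expr2 lerDl.
by apply: sumr_ge0 => k _; rewrite -expr2 sqr_ge0.
Qed.

Lemma coord_le_normr (R : realType) n (x : 'rV[R]_n) j : `|x 0 j| <= `|x|.
Proof.
rewrite [leRHS]/Num.norm /= mx_normrE.
by apply/bigmax_geP; right => /=; exists (0, j).
Qed.

Lemma enorm_le_normr (R : realType) n (x : 'rV[R]_n) : enorm x <= n%:R * `|x|.
Proof.
have n0 : 0 <= n%:R * `|x| by rewrite mulr_ge0.
rewrite -ler_sqr ?nnegrE ?enorm_ge0// sqr_enorm.
apply: (@le_trans _ _ (\sum_(i < n) `|x| ^+ 2)).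
  apply: ler_sum => i _; rewrite -expr2 -real_normK ?num_real//.
  by rewrite ler_sqr ?nnegrE// coord_le_normr.
rewrite sumr_const card_ord -[leLHS]mulr_natl exprMn ler_wpM2r ?sqr_ge0//.
by case: (n) => [|k]; rewrite ?expr0n// expr2 ler_peMl// ler1n.
Qed.

Lemma coordB_continuous (R : realType) n (y : 'rV[R]_n) i :
  continuous (fun x : 'rV[R]_n => x 0 i - y 0 i).
Proof.
move=> x; apply: (@continuousB _ R _ (fun x : 'rV[R]_n => x 0 i) (cst (y 0 i))).
  exact: (@coord_continuous R 1 n 0 i x).
exact: cst_continuous.
Qed.

(** [sqdist y x] is the square of the distance, a polynomial in the coordinates
of [x]: radial test functions written in it are smooth even at [y]. *)
Definition sqdist (R : realType) n (y x : 'rV[R]_n) : R := dotp (x - y) (x - y).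

Lemma sqdist_sqr (R : realType) n (y x : 'rV[R]_n) :
  sqdist y x = enorm (x - y) ^+ 2.
Proof. by rewrite sqr_enorm. Qed.

Lemma sqdistE (R : realType) n (y : 'rV[R]_n) :
  sqdist y = \sum_(i < n) (fun x => (x 0 i - y 0 i) ^+ 2).
Proof.
apply/funext => x; rewrite fct_sumE; apply: eq_bigr => i _.
by rewrite !mxE expr2.
Qed.

Lemma sqdist_continuous (R : realType) n (y : 'rV[R]_n) : continuous (sqdist y).
Proof.
rewrite sqdistE => x.
elim/big_ind: _ => [|f g cf cg|i _].
- by move: x; exact: cst_continuous.
- exact: continuousD.

- apply: (@continuousM R _ (fun x : 'rV[R]_n => x 0 i - y 0 i)
    (fun x : 'rV[R]_n => x 0 i - y 0 i)); exact: coordB_continuous.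
Qed.

Lemma enormB_continuous (R : realType) n (y : 'rV[R]_n) :
  continuous (fun x : 'rV[R]_n => enorm (x - y)).
Proof.
move=> x.
by apply: (@continuous_comp _ _ _ (sqdist y) Num.sqrt);
  [exact: sqdist_continuous|exact: sqrt_continuous].
Qed.

(** A polynomial expansion along the line [x + h v] reads off the directional
derivative. *)
Lemma is_derive_expansion (R : realType) n (f : 'rV[R]_n -> R)
    (x v : 'rV[R]_n) (a b0 b1 b2 : R) :
  (forall h, f (h *: v + x) = f x + a * h + h ^+ 2 * (b0 + b1 * h + b2 * h ^+ 2)) ->
  is_derive x v f a.
Proof.
move=> fE.
have cv : h^-1 *: ((f \o shift x) (h *: v) - f x) @[h --> 0^'] --> a.
  pose p := Poly [:: a; b0; b1; b2].
  have pa : p.[0] = a by rewrite horner_Poly /=; ring.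
  apply: (@cvg_trans _ (horner p @ 0^')); last first.
    rewrite -pa; apply: cvg_within_filter; exact: continuous_horner.
  apply: near_eq_cvg; near=> h.
  have h0 : h != 0 by near: h; exact: nbhs_dnbhs_neq.
  by rewrite horner_Poly /= fE /GRing.scale /=; field.
by apply: DeriveDef; [apply/cvg_ex; exists a|exact/cvg_lim].
Unshelve. all: by end_near. Qed.

Lemma dotp_delta (R : realType) n (z : 'rV[R]_n) i : dotp (delta_mx 0 i) z = z 0 i.
Proof.
rewrite /dotp (bigD1 i) //= big1 => [|j ji]; first by rewrite mxE !eqxx mul1r addr0.
by rewrite mxE (negPf ji) andbF mul0r.
Qed.

Lemma sqdist_delta (R : realType) n (y x : 'rV[R]_n) i h :
  sqdist y (h *: delta_mx 0 i + x) =
  sqdist y x + 2 * h * (x - y) 0 i + h ^+ 2.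
Proof.
rewrite /sqdist -addrA (dotp_sqrD (h *: _) (x - y)) !dotpZl !dotpZr !dotp_delta.
by rewrite mxE !eqxx /=; ring.
Qed.

(** Polynomials of degree two in the squared distance suffice as radial test
functions: at a given point other than [y] they realise every pair of first and
second radial derivatives. *)
Definition radial_test (R : realType) n (y : 'rV[R]_n) (s0 c1 c2 : R)
    (x : 'rV[R]_n) : R :=
  c1 * (sqdist y x - s0) + c2 * (sqdist y x - s0) ^+ 2.

Lemma radial_test_partial (R : realType) n (y : 'rV[R]_n) (s0 c1 c2 : R) x i :
  is_derive x (delta_mx 0 i) (radial_test y s0 c1 c2)
    ((c1 + 2 * c2 * (sqdist y x - s0)) * (2 * (x - y) 0 i)).
Proof.
pose z := (x - y) 0 i; pose D := sqdist y x - s0.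
apply: (@is_derive_expansion _ _ _ _ _ _
  (c1 + c2 * (2 * D + 4 * z ^+ 2)) (4 * c2 * z) c2) => h.
rewrite /radial_test sqdist_delta -/z /D; ring.
Qed.

Lemma partial_radial_test (R : realType) n (y : 'rV[R]_n) (s0 c1 c2 : R) i :
  partial (radial_test y s0 c1 c2) i =
  fun x => (c1 + 2 * c2 * (sqdist y x - s0)) * (2 * (x - y) 0 i).
Proof.
by apply/funext => x; exact: (@derive_val _ _ _ _ _ _ _ (radial_test_partial y s0 c1 c2 x i)).
Qed.

Lemma radial_test_partial2 (R : realType) n (y : 'rV[R]_n) (s0 c1 c2 : R) x i j :
  is_derive x (delta_mx 0 i) (partial (radial_test y s0 c1 c2) j)
    (2 * (c1 + 2 * c2 * (sqdist y x - s0)) * (i == j)%:R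
     + 8 * c2 * (x - y) 0 i * (x - y) 0 j).
Proof.
rewrite partial_radial_test.
pose d : R := (i == j)%:R.
apply: (@is_derive_expansion _ _ _ _ _ _
  (8 * c2 * (x - y) 0 i * d + 4 * c2 * (x - y) 0 j) (4 * c2 * d) 0) => h.
rewrite sqdist_delta.
have -> : (h *: delta_mx 0 i + x - y) 0 j = (x - y) 0 j + h * d.
  by rewrite !mxE eqxx /= /d eq_sym; ring.
rewrite -/d; ring.
Qed.

Lemma partial2_radial_test (R : realType) n (y : 'rV[R]_n) (s0 c1 c2 : R) i j :
  partial (partial (radial_test y s0 c1 c2) j) i =
  fun x => 2 * (c1 + 2 * c2 * (sqdist y x - s0)) * (i == j)%:R
     + 8 * c2 * (x - y) 0 i * (x - y) 0 j.
Proof.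
by apply/funext => x; exact: (@derive_val _ _ _ _ _ _ _ (radial_test_partial2 y s0 c1 c2 x i j)).
Qed.

Lemma radial_test_C2 (R : realType) n (y : 'rV[R]_n) (s0 c1 c2 : R) x :
  C2_near (radial_test y s0 c1 c2) x.
Proof.
have cD c : continuous (fun z : 'rV[R]_n => sqdist y z - c).
  by move=> z; apply: (@continuousB _ R _ (sqdist y) (cst c));
    [exact: sqdist_continuous|exact: cst_continuous].
have cC c (F : 'rV[R]_n -> R) : continuous F -> continuous (fun z => c * F z).
  move=> cF z; apply: (@continuousM R _ (cst c) F z); last exact: cF.
  exact: cst_continuous.
have cP (F G : 'rV[R]_n -> R) : continuous F -> continuous G ->
    continuous (fun z => F z + G z).
  by move=> cF cG z; apply: (@continuousD _ R _ F G z); [exact: cF|exact: cG].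
have cM (F G : 'rV[R]_n -> R) : continuous F -> continuous G ->
    continuous (fun z => F z * G z).
  by move=> cF cG z; apply: (@continuousM R _ F G z); [exact: cF|exact: cG].
have cK : continuous (fun z : 'rV[R]_n => c1 + 2 * c2 * (sqdist y z - s0)).
  by apply: (cP (cst c1)); [exact: cst_continuous|exact: cC].
have cZ i : continuous (fun z : 'rV[R]_n => (z - y) 0 i).
  have -> : (fun z : 'rV[R]_n => (z - y) 0 i) = fun z => z 0 i - y 0 i.
    by apply/funext => z; rewrite !mxE.
  exact: coordB_continuous.
near=> z; split => [|i|i j].
- by apply: cP; apply: cC => //; exact: cM.
- split; first exact: (@ex_derive _ _ _ _ _ _ _ (radial_test_partial y s0 c1 c2 z i)).
  by rewrite partial_radial_test; apply: cM => //; exact: cC.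
- split; first exact: (@ex_derive _ _ _ _ _ _ _ (radial_test_partial2 y s0 c1 c2 z i j)).
  rewrite partial2_radial_test; apply: cP.
    by apply: cM; [exact: cC|exact: cst_continuous].
  by apply: cM => //; exact: cC.
Unshelve. all: by end_near. Qed.

Lemma gradient_radial_test (R : realType) n (y : 'rV[R]_n) (s0 c1 c2 : R) x :
  gradient (radial_test y s0 c1 c2) x =
  (2 * (c1 + 2 * c2 * (sqdist y x - s0))) *: (x - y).
Proof. by apply/rowP => i; rewrite !mxE partial_radial_test !mxE; ring. Qed.

(** The Hessian is a multiple of the identity plus a multiple of the rank one
matrix [z^T z] with [z = x - y]. *)
Lemma quad_form_radial_test (R : realType) n (y : 'rV[R]_n) (s0 c1 c2 : R) x e :
  quad_form (hessian (radial_test y s0 c1 c2) x) e =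
  2 * (c1 + 2 * c2 * (sqdist y x - s0)) * dotp e e + 8 * c2 * dotp (x - y) e ^+ 2.
Proof.
rewrite /quad_form; set z := x - y; set k := _ + _ * (_ - s0).
have -> : e *m (hessian (radial_test y s0 c1 c2) x)^T =
    (2 * k) *: e + (8 * c2 * dotp z e) *: z.
  apply/rowP => i; rewrite !mxE.
  under eq_bigr => j _ do
    rewrite !mxE partial2_radial_test -/z -/k mulrDr (mulrCA (e 0 j)).
  rewrite big_split /=; congr (_ + _).
    rewrite -mulr_sumr (bigD1 i) //= big1 => [|j ji].
      by rewrite eqxx mulr1 addr0.
    by rewrite eq_sym (negPf ji) mulr0.
  rewrite /dotp mulr_sumr mulr_suml; apply: eq_bigr => j _.
  by rewrite /z !mxE; ring.
by rewrite dotpDl !dotpZl expr2; ring.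
Qed.

(** The radial test function with slope [m] and second radial derivative [k]
at distance [r0] from [y]; the second derivative in the variable [r] of
[c1 (r^2 - r0^2) + c2 (r^2 - r0^2)^2] at [r0] is [2 c1 + 8 c2 r0^2]. *)
Definition radial_jet (R : realType) n (y : 'rV[R]_n) (r0 m k : R) :
    'rV[R]_n -> R :=
  radial_test y (r0 ^+ 2) (m / (2 * r0)) ((k - m / r0) / (8 * r0 ^+ 2)).

Section RadialJet.
Variables (R : realType) (n : nat) (y x0 : 'rV[R]_n) (m k : R).
Let r0 := enorm (x0 - y).
Hypothesis r0_gt0 : 0 < r0.

Let sqdist0 : sqdist y x0 - r0 ^+ 2 = 0.
Proof. by rewrite sqdist_sqr subrr. Qed.

Lemma gradient_radial_jet :
  gradient (radial_jet y r0 m k) x0 = (m / r0) *: (x0 - y).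
Proof.
rewrite gradient_radial_test sqdist0 mulr0 addr0; congr (_ *: _).
by field; rewrite gt_eqF.
Qed.

Lemma enorm_gradient_radial_jet : enorm (gradient (radial_jet y r0 m k) x0) = `|m|.
Proof.
by rewrite gradient_radial_jet enormZ normrM normfV (gtr0_norm r0_gt0)
  -/r0 mulfVK// gt_eqF.
Qed.

Lemma gradient_radial_jet_eq0 : (gradient (radial_jet y r0 m k) x0 == 0) = (m == 0).
Proof.
apply/eqP/eqP => [g0|m0]; last by rewrite gradient_radial_jet m0 mul0r scale0r.
by apply/normr0_eq0; rewrite -enorm_gradient_radial_jet g0 enorm0.
Qed.

Lemma ninflap_radial_jet : m != 0 ->
  enorm (gradient (radial_jet y r0 m k) x0) ^- 2 *
  quad_form (hessian (radial_jet y r0 m k) x0) (gradient (radial_jet y r0 m k) x0)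
  = k.
Proof.
move=> m0; rewrite enorm_gradient_radial_jet real_normK ?num_real//.
rewrite quad_form_radial_test sqdist0 gradient_radial_jet.
rewrite !dotpZr dotpZl -sqr_enorm -/r0; field.
by rewrite m0 gt_eqF.
Qed.

Lemma radial_jet0 : radial_jet y r0 m k x0 = 0.
Proof. by rewrite /radial_jet /radial_test sqdist0 expr0n !mulr0 addr0. Qed.

(** In [d = r - r0] the test function is
[m d + d^2 (c1 + c2 (r + r0)^2)], and the bracket tends to [k / 2]. *)
Lemma near_radial_jet_ge (k' : R) : k' < k ->
  \forall x \near x0, m * (enorm (x - y) - r0) + k' / 2 * (enorm (x - y) - r0) ^+ 2
    <= radial_jet y r0 m k x.
Proof.
move=> kk; pose c2 := (k - m / r0) / (8 * r0 ^+ 2).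
pose E (x : 'rV[R]_n) := m / (2 * r0) + c2 * (enorm (x - y) + r0) ^+ 2.
have cr : continuous (fun x : 'rV[R]_n => enorm (x - y) + r0).
  move=> x; apply: (@continuousD _ R _ (fun x : 'rV[R]_n => enorm (x - y)) (cst r0)).
    exact: enormB_continuous.
  exact: cst_continuous.
have cE : continuous E.
  move=> x; apply: (@continuousD _ R _ (cst (m / (2 * r0)))
    (fun x : 'rV[R]_n => c2 * (enorm (x - y) + r0) ^+ 2)); first exact: cst_continuous.
  apply: (@continuousM R _ (cst c2) (fun x : 'rV[R]_n => (enorm (x - y) + r0) ^+ 2)).
    exact: cst_continuous.
  by apply: continuousM; exact: cr.
have E0 : E x0 = k / 2.
  by rewrite /E /c2 -/r0; field; rewrite gt_eqF.
have : k' / 2 < E x0 by rewrite E0; lra.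
move=> /(cvgr_gt (E x0) (cE x0)) nE; near=> x.
have kE : k' / 2 < E x by near: x.
have -> : radial_jet y r0 m k x =
    m * (enorm (x - y) - r0) + E x * (enorm (x - y) - r0) ^+ 2.
  rewrite /radial_jet /radial_test sqdist_sqr /E -/c2.
  set r := enorm (x - y); field; rewrite gt_eqF//.
by rewrite lerD2l ler_wpM2r ?sqr_ge0// ltW.
Unshelve. all: by end_near. Qed.

End RadialJet.

Lemma radial_jetN (R : realType) n (y : 'rV[R]_n) (r0 m k : R) x :
  radial_jet y r0 (- m) (- k) x = - radial_jet y r0 m k x.
Proof. by rewrite /radial_jet /radial_test !mulNr; ring. Qed.

Lemma near_radial_jet_le (R : realType) n (y x0 : 'rV[R]_n) (m k k' : R) :
  0 < enorm (x0 - y) -> k < k' ->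
  \forall x \near x0, radial_jet y (enorm (x0 - y)) m k x <=
    m * (enorm (x - y) - enorm (x0 - y))
    + k' / 2 * (enorm (x - y) - enorm (x0 - y)) ^+ 2.
Proof.
move=> r0 kk; have kk' : - k' < - k by rewrite ltrN2.
have := near_radial_jet_ge (- m) r0 kk'; apply: filterS => x.
by rewrite radial_jetN !mulNr -opprD lerN2.
Qed.

(** The parabola in [|x - y|] need not be a smooth test function itself; the jet
with curvature [k + e] lies above it near [x0], and [e] is then sent to zero. *)
Lemma subsolution_radial (R : realType) n (Omega : set 'rV[R]_n) q f g u
    (y x0 : 'rV[R]_n) (m k : R) :
  viscosity_subsolution Omega (rhs q f g) u -> Omega x0 ->
  0 < enorm (x0 - y) -> m != 0 ->
  (\forall x \near x0, u x <= u x0 + m * (enorm (x - y) - enorm (x0 - y))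
    + k / 2 * (enorm (x - y) - enorm (x0 - y)) ^+ 2) ->
  f (u x0) + g (u x0) * `|m| `^ q <= k.
Proof.
move=> [_ su] Ox0 r0 m0 nu; apply/ler_addgt0Pr => e e0.
have ke : k < k + e by rewrite ltrDl.
have := su x0 (radial_jet y (enorm (x0 - y)) m (k + e)) Ox0 (radial_test_C2 _ _ _ _ _).
rewrite /ninflap_upper gradient_radial_jet_eq0//.
rewrite (negPf m0) ninflap_radial_jet// /rhs enorm_gradient_radial_jet//.
apply; have nr := near_radial_jet_ge m r0 ke; near=> x.
have ux : u x <= u x0 + m * (enorm (x - y) - enorm (x0 - y))
    + k / 2 * (enorm (x - y) - enorm (x0 - y)) ^+ 2 by near: x.
rewrite radial_jet0// subr0.
have : m * (enorm (x - y) - enorm (x0 - y))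
    + k / 2 * (enorm (x - y) - enorm (x0 - y)) ^+ 2
    <= radial_jet y (enorm (x0 - y)) m (k + e) x by near: x.
lra.
Unshelve. all: by end_near. Qed.

Lemma supersolution_radial (R : realType) n (Omega : set 'rV[R]_n) q f g u
    (y x0 : 'rV[R]_n) (m k : R) :
  viscosity_supersolution Omega (rhs q f g) u -> Omega x0 ->
  0 < enorm (x0 - y) -> m != 0 ->
  (\forall x \near x0, u x0 + m * (enorm (x - y) - enorm (x0 - y))
    + k / 2 * (enorm (x - y) - enorm (x0 - y)) ^+ 2 <= u x) ->
  k <= f (u x0) + g (u x0) * `|m| `^ q.
Proof.
move=> [_ su] Ox0 r0 m0 nu; apply/ler_addgt0Pr => e e0; rewrite -lerBlDr.
have ke : k - e < k by rewrite ltrBlDr ltrDl.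
have := su x0 (radial_jet y (enorm (x0 - y)) m (k - e)) Ox0 (radial_test_C2 _ _ _ _ _).
rewrite /ninflap_lower gradient_radial_jet_eq0//.
rewrite (negPf m0) ninflap_radial_jet// /rhs enorm_gradient_radial_jet//.
apply; have nr := near_radial_jet_le m r0 ke; near=> x.
have ux : u x0 + m * (enorm (x - y) - enorm (x0 - y))
    + k / 2 * (enorm (x - y) - enorm (x0 - y)) ^+ 2 <= u x by near: x.
rewrite radial_jet0// subr0.
have : radial_jet y (enorm (x0 - y)) m (k - e) x
    <= m * (enorm (x - y) - enorm (x0 - y))
    + k / 2 * (enorm (x - y) - enorm (x0 - y)) ^+ 2 by near: x.
lra.
Unshelve. all: by end_near. Qed.

(** At the centre the paraboloid has gradient zero and Hessian [k] times the
identity. *)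
Lemma subsolution_center (R : realType) n (Omega : set 'rV[R]_n) q f g u
    (y : 'rV[R]_n) (k : R) :
  viscosity_subsolution Omega (rhs q f g) u -> Omega y -> q != 0 -> 0 <= k ->
  (\forall x \near y, u x <= u y + k / 2 * enorm (x - y) ^+ 2) ->
  f (u y) <= k.
Proof.
move=> [_ su] Oy q0 k0 nu.
have yy : enorm (y - y) = 0 by rewrite subrr enorm0.
have := su y _ Oy (radial_test_C2 y 0 (k / 2) 0 y).
rewrite /ninflap_upper gradient_radial_test subrr scaler0 eqxx /rhs enorm0.
rewrite powR0// mulr0 addr0 => H; apply: le_trans (H _) _.
  apply: filterS nu => x ux.
  by rewrite /radial_test !sqdist_sqr yy; lra.
have [->|ne] := eqVneq ([set quad_form (hessian (radial_test y 0 (k / 2) 0) y) e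
    | e in [set e : 'rV[R]_n | enorm e = 1]]) set0.
  by rewrite sup0.
apply: ge_sup; first exact/set0P.
move=> _ [e /= e1 <-]; rewrite quad_form_radial_test -sqr_enorm e1.
by rewrite mulr0 !mul0r addr0 mulr0 mul0r addr0; lra.
Qed.

(** * The maximum of a subsolution over concentric balls *)

Lemma compact_annulus (R : realType) n (y : 'rV[R]_n) (a c : R) :
  compact [set x | a <= enorm (x - y) <= c].
Proof.
apply: bounded_closed_compact.
  exists (`|y| + c); split; first exact: num_real.
  move=> M ltM x /= /andP[_ xc].
  rewrite -(subrK y x) (le_trans (ler_normD _ _))// addrC.
  by rewrite (le_trans _ (ltW ltM))// lerD2l (le_trans (normr_le_enorm _)).
have -> : [set x | a <= enorm (x - y) <= c] =
    (fun x : 'rV[R]_n => enorm (x - y)) @^-1` `[a, c].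
  by apply/seteqP; split => x /=; rewrite in_itv.
apply: closed_comp; last exact: itv_closed.
by move=> x _; exact: enormB_continuous.
Qed.

Lemma near_annulus (R : realType) n (y x0 : 'rV[R]_n) (a c : R) :
  a < enorm (x0 - y) -> enorm (x0 - y) < c ->
  \forall x \near x0, a < enorm (x - y) < c.
Proof.
move=> /(cvgr_gt _ (@enormB_continuous R n y x0)) na.
move=> /(cvgr_lt _ (@enormB_continuous R n y x0)) nc.
by near=> x; apply/andP; split; near: x.
Unshelve. all: by end_near. Qed.

Lemma near_enorm_lt (R : realType) n (y x0 : 'rV[R]_n) (c : R) :
  enorm (x0 - y) < c -> \forall x \near x0, enorm (x - y) < c.
Proof. exact: (cvgr_lt _ (@enormB_continuous R n y x0)). Qed.

Lemma radial_within_continuous (R : realType) n (Omega K : set 'rV[R]_n)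
    (u : 'rV[R]_n -> R) (psi : R -> R) (y : 'rV[R]_n) :
  {within Omega, continuous u} -> K `<=` Omega -> continuous psi ->
  {within K, continuous (fun x => u x - psi (enorm (x - y)))}.
Proof.
move=> cu KO cpsi.
have cu' : {within K, continuous u} by exact: continuous_subspaceW cu.
have cp : {within K, continuous (fun x => psi (enorm (x - y)))}.
  apply: continuous_subspaceT => x.
  apply: (@continuous_comp _ _ _ (fun x : 'rV[R]_n => enorm (x - y)) psi).
    exact: enormB_continuous.
  exact: cpsi.
by move=> x; apply: continuousB; [exact: cu'|exact: cp].
Qed.

Lemma annulus_max (R : realType) n (Omega : set 'rV[R]_n)
    (u : 'rV[R]_n -> R) (psi : R -> R) (y x1 : 'rV[R]_n) (a c : R) :
  {within Omega, continuous u} -> continuous psi ->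
  [set x | a <= enorm (x - y) <= c] `<=` Omega ->
  a <= enorm (x1 - y) <= c ->
  exists2 x0, a <= enorm (x0 - y) <= c &
    forall x, a <= enorm (x - y) <= c ->
      u x - psi (enorm (x - y)) <= u x0 - psi (enorm (x0 - y)).
Proof.
move=> cu cpsi KO x1K.
have K0 : [set x | a <= enorm (x - y) <= c] !=set0 by exists x1.
have cf := @radial_within_continuous R n Omega _ u psi y cu KO cpsi.
have [x0 x0K max0] := EVT_max_rV K0 (@compact_annulus R n y a c) cf.
exists x0; first by rewrite inE in x0K.
by move=> x xK; apply: max0; rewrite inE.
Qed.

Lemma quadratic_continuous (R : realType) (a0 a m k : R) :
  continuous (fun r : R => a0 + m * (r - a) + k / 2 * (r - a) ^+ 2).
Proof.
have -> : (fun r : R => a0 + m * (r - a) + k / 2 * (r - a) ^+ 2) =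
    horner (a0%:P + m%:P * ('X - a%:P) + (k / 2)%:P * ('X - a%:P) ^+ 2).
  by apply/funext => r; rewrite !hornerE.
exact: continuous_horner.
Qed.

Definition ballmax (R : realType) n (u : 'rV[R]_n -> R) (y : 'rV[R]_n) (r : R) : R :=
  sup [set u x | x in [set x | enorm (x - y) <= r]].

Lemma ballmaxP (R : realType) n (Omega : set 'rV[R]_n) (u : 'rV[R]_n -> R) y (r : R) :
  {within Omega, continuous u} -> 0 <= r ->
  [set x | enorm (x - y) <= r] `<=` Omega ->
  (forall x, enorm (x - y) <= r -> u x <= ballmax u y r) /\
  exists2 x, enorm (x - y) <= r & u x = ballmax u y r.
Proof.
move=> cu r0 BO.
have ballE x : (0 <= enorm (x - y) <= r) = (enorm (x - y) <= r).
  by rewrite enorm_ge0.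
have [||x0 x0K max0] := @annulus_max R n Omega u (cst 0) y y 0 r cu
  (@cst_continuous _ _ _).
- by move=> x /=; rewrite ballE; exact: BO.
- by rewrite subrr enorm0 lexx.
have ub : forall x, enorm (x - y) <= r -> u x <= u x0.
  by move=> x xr; have := max0 x; rewrite ballE /= !subr0; exact.
rewrite ballE in x0K.
have -> : ballmax u y r = u x0.
  apply/eqP; rewrite eq_le; apply/andP; split.
    by apply: ge_sup; [exists (u x0), x0|move=> _ [x /= xr <-]; exact: ub].
  by apply: ub_le_sup; [exists (u x0) => _ [x /= xr <-]; exact: ub|exists x0].
by split => //; exists x0.
Qed.

(** The one-dimensional properties of [r |-> max of u over the ball of radius r]
on which the growth estimates rest: comparison with convex parabolas starting
from a point of the graph, which encodes [M'' >= f(M) + g(M) M'^q] in the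
viscosity sense, and comparison with centred paraboloids. *)
Record radial_growth (R : realType) (q : R) (f g : R -> R) (t r : R)
    (M : R -> R) : Prop := RadialGrowth {
  growth0 : M 0 = t;
  growth_homo : forall a b, 0 <= a -> a <= b -> b <= r -> M a <= M b;
  growth_comparison : forall a c m k, 0 <= a -> a < c -> c <= r -> 0 <= m ->
    0 < k -> k < f (M a) + g (M a) * m `^ q ->
    M c <= M a + m * (c - a) + k / 2 * (c - a) ^+ 2 ->
    forall b, a <= b -> b <= c -> M b <= M a + m * (b - a) + k / 2 * (b - a) ^+ 2;
  growth_center : forall c k, 0 <= c -> c <= r -> 0 < k -> k < f t ->
    t + k / 2 * c ^+ 2 <= M c }.

Lemma admissible_g_ge0 (R : realType) (f g : R -> R) t :
  admissible f g -> 0 < t -> 0 <= g t.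
Proof. by case=> _ _ _ _; apply. Qed.

Lemma admissible_f_gt0 (R : realType) (f g : R -> R) t :
  admissible f g -> 0 < t -> 0 < f t.
Proof. by case=> _ _ + _ _ => /(_ t)/[apply]/andP[]. Qed.

Lemma admissible_homo (R : realType) (f g : R -> R) :
  admissible f g -> {homo f : x y / x <= y} /\ {homo g : x y / x <= y}.
Proof. by case. Qed.

(** Both comparisons are the maximum principle for [u - psi (|x - y|)]: at an
interior maximum the subsolution inequality, together with the monotonicity of
[f] and [g], contradicts the strict inequality satisfied by the parabola. *)
Lemma ballmax_growth (R : realType) n (Omega : set 'rV[R]_n) q f g u y (r : R) :
  0 < q -> admissible f g ->
  {within Omega, continuous u} -> viscosity_subsolution Omega (rhs q f g) u ->
  0 <= r -> [set x | enorm (x - y) <= r] `<=` Omega -> 0 < u y ->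
  radial_growth q f g (u y) r (ballmax u y).
Proof.
move=> q0 adm cu su r0 BO uy0; have [hf hg] := admissible_homo adm.
have BOs s : s <= r -> [set x | enorm (x - y) <= s] `<=` Omega.
  by move=> sr x /= xs; apply: BO; rewrite /= (le_trans xs).
have MP s : 0 <= s -> s <= r -> (forall x, enorm (x - y) <= s -> u x <= ballmax u y s) /\
    exists2 x, enorm (x - y) <= s & u x = ballmax u y s.
  by move=> s0 sr; exact: ballmaxP cu s0 (BOs _ sr).
have M0 : ballmax u y 0 = u y.
  have [_ [x xy <-]] := MP 0 (lexx 0) r0; congr u.
  apply/eqP; rewrite -subr_eq0; apply/eqP/enorm_eq0.
  by apply/eqP; rewrite eq_le xy enorm_ge0.
have Mh a b : 0 <= a -> a <= b -> b <= r -> ballmax u y a <= ballmax u y b.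
  move=> a0 ab br; have [_ [x xa <-]] := MP a a0 (le_trans ab br).
  by have [ub _] := MP b (le_trans a0 ab) br; apply: ub; exact: le_trans ab.
split => // [a c m k a0 ac cr m0 k0 kfg Mc b ab bc|c k c0 cr k0 kf].
- have [_ [x xb <-]] := MP b (le_trans a0 ab) (le_trans bc cr).
  set Ma := ballmax u y a in kfg Mc *.
  pose psi s := Ma + m * (s - a) + k / 2 * (s - a) ^+ 2.
  have Ma0 : 0 < Ma by rewrite (lt_le_trans uy0)// -M0 Mh// (le_trans _ cr)// ltW.
  have psiM s s' : a <= s -> s <= s' -> psi s <= psi s'.
    move=> as_ ss'; rewrite /psi lerD ?lerD2l ?ler_wpM2l ?lerD2r//.
      by rewrite divr_ge0// ltW.
    by rewrite ler_sqr ?nnegrE ?subr_ge0// ?lerD2r// (le_trans as_).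
  have psia : psi a = Ma by rewrite /psi subrr; ring.
  have [uba _] := MP a a0 (le_trans (ltW ac) cr); rewrite -/Ma in uba.
  have [xa|ax] := leP (enorm (x - y)) a.
    by rewrite -/(psi b) (le_trans (uba _ xa))// -[leLHS]psia psiM.
  suff : u x - psi (enorm (x - y)) <= 0.
    by rewrite subr_le0 => /le_trans; apply; rewrite psiM// ltW.
  have KO : [set x | a <= enorm (x - y) <= c] `<=` Omega.
    by move=> z /= /andP[_ zc]; exact: (BOs c cr).
  have [|x0 /andP[ax0 x0c] max0] := @annulus_max R n Omega u psi y x a c cu
    (@quadratic_continuous R Ma a m k) KO.
    by rewrite (ltW ax) (le_trans xb).
  rewrite -/psi in max0.
  apply: le_trans (max0 x _) _; first by rewrite (ltW ax) (le_trans xb).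
  rewrite leNgt; apply/negP; rewrite subr_gt0 => w0.
  (* On the inner and outer spheres [u] is at most [psi]. *)
  have ax0' : a < enorm (x0 - y).
    rewrite lt_neqAle ax0 andbT; apply/negP => /eqP ax0E.
    move: w0; rewrite -ax0E psia; apply/negP; rewrite -leNgt.
    by apply: uba; rewrite ax0E.
  have x0c' : enorm (x0 - y) < c.
    rewrite lt_neqAle x0c andbT; apply/negP => /eqP x0cE.
    move: w0; rewrite x0cE; apply/negP; rewrite -leNgt.
    have [ubc _] := MP c (le_trans a0 (ltW ac)) cr.
    by apply: le_trans (ubc _ _) Mc; rewrite x0cE.
  pose m0' := m + k * (enorm (x0 - y) - a).
  have mm : m < m0' by rewrite ltrDl mulr_gt0// subr_gt0.
  have : f (u x0) + g (u x0) * `|m0'| `^ q <= k.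
    apply: (@subsolution_radial _ _ _ _ _ _ _ y x0 m0' k su).
    - by apply: KO; rewrite /= ax0 x0c.
    - exact: le_lt_trans ax0'.
    - by rewrite gt_eqF// (le_lt_trans m0).
    near=> z; have : a < enorm (z - y) < c by near: z; exact: near_annulus.
    move=> /andP[/ltW az /ltW zc].
    by have := max0 z; rewrite az zc => /(_ isT); rewrite /psi /m0'; lra.
  apply/negP; rewrite -ltNge (lt_le_trans kfg)//.
  have Mau : Ma <= u x0 by rewrite -psia (le_trans (psiM _ _ _ ax0))// ltW.
  rewrite lerD ?hf// ler_pM ?hg ?powR_ge0 ?(admissible_g_ge0 adm)//.
  rewrite ger0_norm ?(le_trans m0) ?(ltW mm)//.
  by rewrite ge0_ler_powR ?nnegrE ?(ltW q0) ?(ltW mm)// (le_trans m0 (ltW mm)).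
- rewrite leNgt; apply/negP => Mc.
  pose psi s := 0 + 0 * (s - 0) + k / 2 * (s - 0) ^+ 2.
  have psiE s : psi s = k / 2 * s ^+ 2 by rewrite /psi; ring.
  have KO : [set x | 0 <= enorm (x - y) <= c] `<=` Omega.
    by move=> z /= /andP[_ zc]; exact: (BOs c cr).
  have yK : 0 <= enorm (y - y) <= c by rewrite subrr enorm0 lexx.
  have [x0 /andP[x00 x0c] max0] := @annulus_max R n Omega u psi y y 0 c cu
    (@quadratic_continuous R 0 0 0 k) KO yK.
  have /= := max0 y yK; rewrite -!/(psi _) !psiE subrr enorm0 => w0.
  have uyx0 : u y <= u x0 by have := sqr_ge0 (enorm (x0 - y)); nra.
  have x0c' : enorm (x0 - y) < c.
    rewrite lt_neqAle x0c andbT; apply/negP => /eqP x0cE.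
    have [ubc _] := MP c c0 cr; have := ubc x0; rewrite x0cE lexx => /(_ isT).
    by move: w0; rewrite x0cE; lra.
  have nx0 : \forall z \near x0, u z <=
      u x0 - k / 2 * enorm (x0 - y) ^+ 2 + k / 2 * enorm (z - y) ^+ 2.
    near=> z; have zc : enorm (z - y) < c by near: z; exact: near_enorm_lt.
    have := max0 z; rewrite enorm_ge0 (ltW zc) => /(_ isT) /=.
    by rewrite -!/(psi _) !psiE; lra.
  have Ox0 : Omega x0 by apply: KO; rewrite /= x00 x0c.
  suff : f (u x0) <= k by apply/negP; rewrite -ltNge (lt_le_trans kf)// hf.
  have [e0|e0] := eqVneq (enorm (x0 - y)) 0.
    have x0y : x0 = y by apply/eqP; rewrite -subr_eq0; apply/eqP/enorm_eq0.
    rewrite x0y in nx0 Ox0 *.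
    apply: (subsolution_center su Ox0); rewrite ?gt_eqF ?(ltW k0)//.
    by apply: filterS nx0 => z; rewrite subrr enorm0; lra.
  have e0' : 0 < enorm (x0 - y) by rewrite lt_neqAle eq_sym e0.
  have : f (u x0) + g (u x0) * `|k * enorm (x0 - y)| `^ q <= k.
    apply: (@subsolution_radial _ _ _ _ _ _ _ y x0 _ k su) => //.
      by rewrite gt_eqF// mulr_gt0.
    by apply: filterS nx0 => z; lra.
  apply: le_trans; rewrite lerDl mulr_ge0 ?powR_ge0// (admissible_g_ge0 adm)//.
  exact: lt_le_trans uyx0.
Unshelve. all: by end_near. Qed.

(** * Growth of the slope of the maximum function *)

Lemma lipschitz_within_continuous (R : realType) (P a b : R) (M : R -> R) :
  0 <= P ->
  (forall x y, a <= x -> x <= y -> y <= b -> `|M y - M x| <= P * (y - x)) ->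
  {within `[a, b], continuous M}.
Proof.
move=> P0 lip; apply/subspace_continuousP => x /=.
rewrite in_itv /= => /andP[ax xb]; apply/cvgrPdist_le => e e0.
have P1 : 0 < P + 1 by rewrite ltr_wpDl.
have eP : 0 < e / (P + 1) by rewrite divr_gt0.
have lip' y : a <= y -> y <= b -> `|M x - M y| <= P * `|x - y|.
  move=> ay yb; have [yx|/ltW xy] := leP y x.
    by rewrite (ger0_norm (_ : 0 <= x - y)) ?subr_ge0// lip.
  by rewrite distrC (distrC x) (ger0_norm (_ : 0 <= y - x)) ?subr_ge0// lip.
apply/nbhs_ballP; exists (e / (P + 1)) => //= y; rewrite /ball /= => xy.
rewrite in_itv /= => /andP[ay yb]; rewrite (le_trans (lip' y ay yb))//.
move: xy; rewrite ltr_pdivlMr// => /ltW; apply: le_trans.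
by rewrite mulrC ler_wpM2l// lerDl.
Qed.

(** The sum of the geometric series produced by halving the slope. *)
Definition slope_const (R : realType) (th : R) : R :=
  3 / 2 * 4 `^ th / (1 - 2^-1 `^ (2 - th)).

Lemma half_powR_lt1 (R : realType) (th : R) : th < 2 -> 2^-1 `^ (2 - th) < 1.
Proof.
move=> th2; rewrite -[ltRHS](_ : 1 `^ (2 - th) = 1); last by rewrite powR1.
by rewrite gt0_ltr_powR ?nnegrE//; lra.
Qed.

Lemma slope_const_gt0 (R : realType) (th : R) : th < 2 -> 0 < slope_const th.
Proof.
by move=> th2; rewrite !(mulr_gt0, invr_gt0, powR_gt0, subr_gt0, half_powR_lt1)//.
Qed.

Section Growth.
Variables (R : realType) (q : R) (f g : R -> R) (t r : R) (M : R -> R).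
Hypotheses (adm : admissible f g) (t0 : 0 < t) (r0 : 0 < r).
Hypothesis rg : radial_growth q f g t r M.

Let hf : {homo f : x y / x <= y}. Proof. exact: (admissible_homo adm).1. Qed.
Let hg : {homo g : x y / x <= y}. Proof. exact: (admissible_homo adm).2. Qed.

Lemma growth_ge a : 0 <= a -> a <= r -> t <= M a.
Proof. by move=> a0 ar; rewrite -(growth0 rg); exact: (growth_homo rg). Qed.

Lemma growth_gt0 a : 0 <= a -> a <= r -> 0 < M a.
Proof. by move=> a0 ar; exact: lt_le_trans t0 (growth_ge a0 ar). Qed.

(** Letting the curvature of the comparison parabola tend to zero shows that
[M] lies below its chords. *)
Lemma growth_chord a b c : 0 <= a -> a <= b -> b <= c -> a < c -> c <= r ->
  M b <= M a + (M c - M a) / (c - a) * (b - a).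
Proof.
move=> a0 ab bc ac cr; apply/ler_addgt0Pr => e e0.
have Ma0 := growth_gt0 a0 (le_trans (ltW ac) cr).
have fM : 0 < f (M a) := admissible_f_gt0 adm Ma0.
have ca : 0 < c - a by rewrite subr_gt0.
have D0 : 0 < (c - a) ^+ 2 by rewrite exprn_gt0.
pose k := Num.min (f (M a) / 2) (e / (c - a) ^+ 2).
have k0 : 0 < k by rewrite lt_min !divr_gt0.
have kf : k < f (M a) by rewrite gt_min; apply/orP; left; lra.
have ke : k * (c - a) ^+ 2 <= e by rewrite -ler_pdivlMr// ge_min lexx orbT.
have m0 : 0 <= (M c - M a) / (c - a).
  by rewrite divr_ge0 ?(ltW ca)// subr_ge0 (growth_homo rg)// ltW.
have kfg : k < f (M a) + g (M a) * ((M c - M a) / (c - a)) `^ q.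
  by rewrite (lt_le_trans kf)// lerDl mulr_ge0 ?powR_ge0// (admissible_g_ge0 adm).
apply: le_trans (growth_comparison rg a0 ac cr m0 k0 kfg _ ab bc) _.
  rewrite divfK ?gt_eqF// (_ : M a + (M c - M a) = M c) ?lerDl; last by ring.
  by rewrite mulr_ge0 ?ltW// divr_gt0.
rewrite lerD2l (le_trans _ ke)//.
apply: (@le_trans _ _ (k / 2 * (c - a) ^+ 2)).
  rewrite ler_wpM2l ?divr_ge0 ?(ltW k0)//.
  by rewrite ler_sqr ?nnegrE ?subr_ge0 ?lerD2r// ltW.
by rewrite ler_wpM2r ?(ltW D0)//; lra.
Qed.

Variable r' : R.
Hypothesis r'r : r' < r.

Lemma growth_lipschitz a b : 0 <= a -> a <= b -> b <= r' ->
  M b - M a <= M r / (r - r') * (b - a).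
Proof.
move=> a0 ab br; have rr : 0 < r - r' by rewrite subr_gt0.
have bra : b <= r := le_trans br (ltW r'r).
have ar : a < r := le_lt_trans ab (le_lt_trans br r'r).
have := growth_chord a0 ab bra ar (lexx r); rewrite -lerBlDl => /le_trans; apply.
rewrite ler_wpM2r ?subr_ge0//.
have Mr0 : 0 < M r by rewrite growth_gt0// ltW.
rewrite ler_pdivrMr ?subr_gt0// mulrAC ler_pdivlMr//.
have Ma := growth_gt0 a0 (ltW ar).
have : M r - M a <= M r by lra.
move=> /(ler_wpM2r (ltW rr)) /le_trans; apply.
by rewrite ler_wpM2l ?(ltW Mr0)// lerD2l lerN2 (le_trans ab).
Qed.

Lemma growth_continuous : {within `[0, r'], continuous M}.
Proof.
apply: (@lipschitz_within_continuous _ (M r / (r - r'))).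
  by rewrite divr_ge0 ?subr_ge0 ?(ltW r'r)// ltW// growth_gt0// ltW.
move=> x y x0 xy yr; rewrite ger0_norm ?growth_lipschitz// subr_ge0.
by rewrite (growth_homo rg)// (le_trans yr)// ltW.
Qed.

Lemma growth_IVT b v : 0 <= b -> b <= r' -> t <= v -> v <= M b ->
  exists2 a, 0 <= a <= b & M a = v.
Proof.
move=> b0 br tv vM.
have cM : {within `[0, b], continuous M}.
  apply: continuous_subspaceW growth_continuous => x /=.
  by rewrite !in_itv /= => /andP[-> xb]; exact: le_trans br.
have [|a] := IVT b0 cM (v := v).
  rewrite (growth0 rg) min_l ?max_r ?tv//;
  by apply: growth_ge => //; exact: le_trans (ltW r'r).
by rewrite in_itv; exists a.
Qed.

Lemma growth_argmin a b p : 0 <= a -> a <= b -> b <= r' ->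
  exists2 c, a <= c <= b & forall x, a <= x -> x <= b -> M c + p * (x - c) <= M x.
Proof.
move=> a0 ab br.
have cM : {within `[a, b], continuous (fun x => M x - p * x)}.
  have cM : {within `[a, b], continuous M}.
    apply: continuous_subspaceW growth_continuous => x /=.
    rewrite !in_itv /= => /andP[ax xb]; rewrite (le_trans a0 ax) /=.
    exact: le_trans br.
  move=> x; apply: continuousB; first exact: cM.
  by apply: continuous_subspaceT; exact: mulrl_continuous.
have [c] := EVT_min ab cM; rewrite in_itv => cab minc; exists c => // x ax xb.
have := minc x; rewrite in_itv /= ax xb => /(_ isT); lra.
Qed.

(** Both terms of the equation are treated at once: [lam m^th] stands for
[f (M a0)], with [th = 0], or for [g (M a0) m^q]. *)
Section SlopeGain.
Variables (a0 lam th : R).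
Hypotheses (a00 : 0 <= a0) (lam0 : 0 < lam) (th2 : th < 2).
Hypothesis lamP : forall m, 0 < m -> lam * m `^ th <= f (M a0) + g (M a0) * m `^ q.

(** The slope of [M] halves within a controlled distance when moving to the
left: were [b - a] longer, the comparison parabola of initial slope [p / 4] at
[a] would still lie above [M] at [b], hence above [M] near [a], where the slope
of [M] is at least [p / 2]. *)
Lemma slope_halving b p : a0 <= b -> b <= r' -> 0 < p ->
  (forall x, a0 <= x -> x <= b -> M b + p * (x - b) <= M x) ->
  exists2 a, a0 <= a <= b &
    (forall x, a0 <= x -> x <= a -> M a + p / 2 * (x - a) <= M x) /\
    lam * (M b - M a) <= 3 / 2 * 4 `^ th * p `^ (2 - th).
Proof.
move=> a0b br p0 Sb.
have [a /andP[a0a ab] Sa] := growth_argmin (p / 2) a00 a0b br.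
exists a; first by rewrite a0a.
split; first by move=> x a0x xa; rewrite Sa// (le_trans xa).
have a_ge0 := le_trans a00 a0a.
have br2 : b <= r := le_trans br (ltW r'r).
have ar : a <= r := le_trans ab br2.
have gA : 0 <= g (M a0) by rewrite (admissible_g_ge0 adm)// growth_gt0// (le_trans a0a).
have MA : M a0 <= M a by rewrite (growth_homo rg).
have p4 : 0 < p / 4 by rewrite divr_gt0.
pose L := b - a.
have Lbound : lam * (p / 4) `^ th * L <= 3 * (p / 2).
  have [L0|] := eqVneq L 0; first by rewrite L0 mulr0 mulr_ge0// divr_ge0// ltW.
  move=> L0; have {}L0 : 0 < L by rewrite lt_neqAle eq_sym L0 subr_ge0.
  rewrite -ler_pdivlMr// leNgt; apply/negP => kL.
  pose k := 3 * (p / 2) / L.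
  have k0 : 0 < k by rewrite divr_gt0// mulr_gt0// divr_gt0.
  have kfg : k < f (M a) + g (M a) * (p / 4) `^ q.
    rewrite (lt_le_trans kL)// (le_trans (lamP p4))// lerD ?hf//.
    by rewrite ler_wpM2r ?powR_ge0// hg.
  have ab' : a < b by rewrite -subr_gt0.
  have kLE : k * L = 3 * (p / 2) by rewrite /k divfK// gt_eqF.
  have Mb : M b <= M a + p / 4 * (b - a) + k / 2 * (b - a) ^+ 2.
    have := Sb a a0a ab; rewrite -/L expr2.
    have -> : k / 2 * (L * L) = (k * L) * L / 2 by ring.
    by rewrite kLE -(opprB b a) -/L; lra.
  (* At distance [L / 6] the parabola has risen by [p L / 16] only, and [M] by
  [p L / 12]. *)
  have x1a : a <= a + L / 6 by rewrite lerDl; lra.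
  have x1b : a + L / 6 <= b by rewrite -lerBrDl -/L; lra.
  have := growth_comparison rg a_ge0 ab' br2 (ltW p4) k0 kfg Mb x1a x1b.
  have := Sa _ (le_trans a0a x1a) x1b.
  have -> : a + L / 6 - a = L / 6 by ring.
  have -> : k / 2 * (L / 6) ^+ 2 = (k * L) * L / 72 by field.
  have pL : 0 < p * L by rewrite mulr_gt0.
  by rewrite kLE; lra.
have Mba : M b - M a <= p * L by have := Sb a a0a ab; rewrite /L; lra.
apply: le_trans (ler_wpM2l (ltW lam0) Mba) _.
have pth : 0 < p `^ th by rewrite powR_gt0.
have p4E : (p / 4) `^ th = p `^ th / 4 `^ th.
  have i4 : 4^-1 `^ th = (4 `^ th)^-1 :> R.
    by rewrite -[4^-1]powR_inv1// -powRrM mulN1r powRN.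
  by rewrite powRM ?invr_ge0 ?(ltW p0)// i4.
have fth : 0 < 4 `^ th :> R by rewrite powR_gt0.
have -> : p `^ (2 - th) = p ^+ 2 / p `^ th.
  by rewrite powRB ?(gt_eqF p0) ?implybT// -powR_mulrn ?(ltW p0).
rewrite [leRHS]mulrA ler_pdivlMr//.
have -> : lam * (p * L) * p `^ th =
    4 `^ th * p * (lam * (p / 4) `^ th * L).
  by rewrite p4E; field; rewrite gt_eqF.
have -> : 3 / 2 * 4 `^ th * p ^+ 2 = 4 `^ th * p * (3 * (p / 2)) by field.
by rewrite ler_wpM2l// mulr_ge0// ltW.
Qed.

(** Halving the slope again and again gives a geometric series, as [th < 2];
the point reached after [J] halvings lies at most [p r' / 2^J] above [M a0]. *)
Lemma slope_gain b p : a0 <= b -> b <= r' -> 0 < p ->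
  (forall x, a0 <= x -> x <= b -> M b + p * (x - b) <= M x) ->
  lam * (M b - M a0) <= slope_const th * p `^ (2 - th).
Proof.
move=> a0b br p0 Sb.
suff approx J : lam * (M b - M a0) <=
    slope_const th * p `^ (2 - th) + lam * p * r' / (2 ^+ J).
  apply/ler_addgt0Pr => e e0.
  have := upper_nthrootP (leqnn (Num.bound (lam * p * r' / e))).
  set J := Num.bound _ => ltJ; apply: le_trans (approx J) _.
  rewrite lerD2l ler_pdivrMr ?exprn_gt0//.
  by rewrite [leRHS]mulrC; move: ltJ; rewrite ltr_pdivrMr// => /ltW.
elim: J b p a0b br p0 Sb => [|J IH] b p a0b br p0 Sb.
  rewrite expr0 divr1 -mulrA -[leLHS]add0r lerD//.
    by rewrite mulr_ge0 ?powR_ge0// ltW// slope_const_gt0.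
  rewrite ler_wpM2l ?(ltW lam0)//; have := Sb a0 (lexx _) a0b.
  have bar : b - a0 <= r' by rewrite (le_trans _ br)// gerBl.
  have : p * (b - a0) <= p * r' by rewrite ler_wpM2l ?(ltW p0).
  lra.
have [a /andP[a0a ab] [Sa gain]] := slope_halving a0b br p0 Sb.
have := IH a (p / 2) a0a (le_trans ab br) (divr_gt0 p0 (ltr0n _ 2)) Sa.
have -> : lam * (p / 2) * r' / 2 ^+ J = lam * p * r' / 2 ^+ J.+1.
  by rewrite exprS; field; rewrite expf_neq0.
have h1 : 1 - 2^-1 `^ (2 - th) != 0 :> R.
  by rewrite gt_eqF// subr_gt0 half_powR_lt1.
have -> : slope_const th * (p / 2) `^ (2 - th) =
    slope_const th * p `^ (2 - th) - 3 / 2 * 4 `^ th * p `^ (2 - th).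
  rewrite powRM ?invr_ge0 ?(ltW p0)// /slope_const; field.
  exact: h1.
lra.
Qed.

(** The point where [M x - p x] is minimal has slope [p] on both sides, so by
[slope_gain] it comes before [M] has risen by [s]. *)
Lemma slope_after s b c p : 0 < s -> a0 <= b -> b <= c -> c <= r' ->
  M a0 + s <= M b -> 0 < p -> slope_const th * p `^ (2 - th) < lam * s ->
  p * (c - b) <= M c - M a0.
Proof.
move=> s0 a0b bc cr sM p0 Kp.
have a0c := le_trans a0b bc.
have [x /andP[a0x xc] Sx] := growth_argmin p a00 a0c cr.
have gain : lam * (M x - M a0) < lam * s.
  apply: le_lt_trans Kp; apply: slope_gain => // [|z a0z zx].
    exact: le_trans cr.
  by apply: Sx => //; exact: le_trans xc.
rewrite ltr_pM2l// in gain.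
have xb : x <= b.
  rewrite leNgt; apply/negP => /ltW bx.
  have : M b <= M x.
    rewrite (growth_homo rg)//; first exact: le_trans a0b.
    by rewrite (le_trans xc)// (le_trans cr)// ltW.
  lra.
have := Sx c a0c (lexx c).
have : p * (c - b) <= p * (c - x) by rewrite ler_wpM2l ?(ltW p0)// lerD2l lerN2.
have : M a0 <= M x.
  by rewrite (growth_homo rg)// (le_trans xc)// (le_trans cr)// ltW.
lra.
Qed.

Lemma slope_time s b c : 0 < s -> a0 <= b -> b <= c -> c <= r' ->
  M a0 + s <= M b ->
  (c - b) * (lam * s) `^ (2 - th)^-1 <=
    (2 * slope_const th) `^ (2 - th)^-1 * (M c - M a0).
Proof.
move=> s0 a0b bc cr sM; have K0 := slope_const_gt0 th2.
have i0 : 2 - th != 0 by rewrite gt_eqF// subr_gt0.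
have K2 : 0 < 2 * slope_const th by rewrite mulr_gt0.
have Z0 : 0 < lam * s / (2 * slope_const th) by rewrite divr_gt0// mulr_gt0.
pose p := (lam * s / (2 * slope_const th)) `^ (2 - th)^-1.
have p0 : 0 < p by rewrite powR_gt0.
have pK : slope_const th * p `^ (2 - th) = lam * s / 2.
  rewrite -powRrM mulVf// powRr1 ?(ltW Z0)//.
  by field; rewrite gt_eqF.
have := slope_after s0 a0b bc cr sM p0; rewrite pK => H.
have {H} : p * (c - b) <= M c - M a0.
  have ls : 0 < lam * s by rewrite mulr_gt0.
  by apply: H; lra.
move=> /(ler_wpM2l (powR_ge0 (2 * slope_const th) (2 - th)^-1)).
apply: le_trans; rewrite mulrA -powRM ?(ltW K2) ?(ltW Z0)//.
rewrite [X in X `^ _ * _](_ : _ = lam * s) 1?mulrC//.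
by field; rewrite gt_eqF.
Qed.

End SlopeGain.

(** The analogue of [M'^2 >= 2 f s] and [M'^(2 - q) >= (2 - q) g s], obtained by
integrating [M'' >= f] and [M'' >= g M'^q] once: after an increase of [s] the
slope of [M] is at least a multiple of either power. *)
Lemma crossing_time : q < 2 -> forall a b c s, 0 <= a -> 0 < s -> a <= b ->
  b <= c -> c <= r' -> M a + s <= M b ->
  (c - b) * ((f (M a) * s) `^ 2^-1 + (g (M a) * s) `^ (2 - q)^-1) <=
    ((2 * slope_const 0) `^ 2^-1 + (2 * slope_const q) `^ (2 - q)^-1)
    * (M c - M a).
Proof.
move=> q2 a b c s a0 s0 ab bc cr sM.
have ar : a <= r by rewrite (le_trans ab)// (le_trans bc)// (le_trans cr)// ltW.
have Ma0 := growth_gt0 a0 ar.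
have fM := admissible_f_gt0 adm Ma0; have gM := admissible_g_ge0 adm Ma0.
rewrite mulrDr [leRHS]mulrDl lerD//.
  have := @slope_time a (f (M a)) 0 a0 fM (ltr0n _ 2) _ s b c s0 ab bc cr sM.
  rewrite subr0; apply=> m m0; rewrite powRr0 mulr1 lerDl.
  by rewrite mulr_ge0// powR_ge0.
have MM : M a <= M c.
  by rewrite (growth_homo rg)// ?(le_trans ab)// (le_trans cr)// ltW.
have [gM0|gM0] := eqVneq (g (M a)) 0.
  rewrite gM0 mul0r powR0 ?mulr0; last by rewrite invr_neq0// gt_eqF// subr_gt0.
  by rewrite mulr_ge0 ?powR_ge0// subr_ge0.
apply: slope_time => //.
  by rewrite lt_neqAle eq_sym gM0.
by move=> m m0; rewrite lerDr ltW.
Qed.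

End Growth.

(** * Crossing times of dyadic levels *)

(** Up to a constant factor, a lower bound for the slope of [M] beyond the level
[t + 2 s]: this is [crossing_time] with the increase [s] above [t + s]. *)
Definition forced_slope (R : realType) (q : R) (f g : R -> R) (t s : R) : R :=
  (f (t + s) * s) `^ 2^-1 + (g (t + s) * s) `^ (2 - q)^-1.

Definition crossing_const (R : realType) (q : R) : R :=
  3 * ((2 * slope_const 0) `^ 2^-1 + (2 * slope_const q) `^ (2 - q)^-1).

Lemma crossing_const_gt0 (R : realType) (q : R) : q < 2 -> 0 < crossing_const q.
Proof.
move=> q2; rewrite mulr_gt0// ltr_wpDr ?powR_ge0// powR_gt0// mulr_gt0//.
exact: slope_const_gt0.
Qed.

Lemma forced_slope_gt0 (R : realType) (q : R) (f g : R -> R) (t s : R) :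
  admissible f g -> 0 < t -> 0 < s -> 0 < forced_slope q f g t s.
Proof.
move=> adm t0 s0; rewrite ltr_wpDr ?powR_ge0// powR_gt0// mulr_gt0//.
by rewrite (admissible_f_gt0 adm)// addr_gt0.
Qed.

(** The first level is reached fast because of the centred paraboloid; from there
the dyadic levels are crossed one after the other at their forced slopes. *)
Lemma growth_radius (R : realType) (q : R) (f g : R -> R) (t r r' s0 : R) (M : R -> R) :
  0 < q < 2 -> admissible f g -> 0 < t -> 0 <= r' -> r' < r ->
  radial_growth q f g t r M -> 0 < s0 ->
  forall k x, 0 <= x -> x <= r' -> M x <= t + 2 * (s0 * 2 ^+ k) ->
  x <= Num.sqrt (4 * s0 / f t) + crossing_const q *
    \sum_(i < k) (s0 * 2 ^+ i / forced_slope q f g t (s0 * 2 ^+ i)).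
Proof.
move=> /andP[q0 q2] adm t0 r'0 r'r rg s00.
have r0 : 0 < r := le_lt_trans r'0 r'r.
have ft : 0 < f t := admissible_f_gt0 adm t0.
elim=> [|k IH] x x0 xr.
  rewrite expr0 mulr1 big_ord0 mulr0 addr0 => Mx.
  rewrite -(ger0_norm x0) -sqrtr_sqr ler_wsqrtr// ler_pdivlMr//.
  rewrite leNgt; apply/negP => lt4.
  pose kap := 4 * s0 / x ^+ 2.
  have x2 : 0 < x ^+ 2.
    by rewrite lt_neqAle sqr_ge0 andbT; apply/negP => /eqP x20; move: lt4; rewrite -x20; lra.
  have kap0 : 0 < kap by rewrite divr_gt0// mulr_gt0.
  have kapf : kap < f t by rewrite ltr_pdivrMr// [ltRHS]mulrC.
  pose kap' := (kap + f t) / 2.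
  have kk' : kap < kap' by rewrite /kap'; lra.
  have kf' : kap' < f t by rewrite /kap'; lra.
  have := growth_center rg x0 (le_trans xr (ltW r'r)) (lt_trans kap0 kk') kf'.
  have : kap * x ^+ 2 < kap' * x ^+ 2 by rewrite ltr_pM2r.
  have -> : kap * x ^+ 2 = 4 * s0 by rewrite /kap divfK// gt_eqF.
  lra.
move=> Mx; pose s := s0 * 2 ^+ k.
have s_gt0 : 0 < s by rewrite mulr_gt0// exprn_gt0.
have sE : s0 * 2 ^+ k.+1 = 2 * s by rewrite /s exprS; ring.
have W0 := forced_slope_gt0 q adm t0 s_gt0.
rewrite big_ord_recr /= -/s mulrDr addrA.
have [Mx2|Mx2] := leP (M x) (t + 2 * s).
  apply: le_trans (IH x x0 xr Mx2) _; rewrite lerDl mulr_ge0//.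
    by rewrite ltW// crossing_const_gt0.
  by rewrite divr_ge0// ltW.
have t2s : t <= t + 2 * s by rewrite lerDl; lra.
have [b /andP[b0 bx] Mb] := growth_IVT adm t0 r0 rg r'r x0 xr t2s (ltW Mx2).
have ts : t <= t + s by rewrite lerDl; lra.
have tsb : t + s <= M b by rewrite Mb; lra.
have [a /andP[a0 ab] Ma] := growth_IVT adm t0 r0 rg r'r b0 (le_trans bx xr) ts tsb.
have Mab : M a + s <= M b by rewrite Ma Mb; lra.
have bB := IH b b0 (le_trans bx xr) ltac:(by rewrite Mb).
have := crossing_time adm t0 r0 rg r'r q2 a0 s_gt0 ab bx xr Mab.
rewrite Ma -/(forced_slope q f g t s) -ler_pdivlMr// => xb.
have := lerD bB xb; rewrite [b + _]addrC subrK => /le_trans; apply.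
rewrite lerD2l [leRHS]mulrA ler_wpM2r ?invr_ge0 ?(ltW W0)//.
rewrite /crossing_const -mulrA [leRHS]mulrCA ler_wpM2l//.
  by rewrite addr_ge0 ?powR_ge0.
rewrite lerBlDr (le_trans Mx)// sE.
by rewrite (_ : t + 2 * (2 * s) = 3 * s + (t + s)) //; ring.
Qed.

(** The discrete Keller-Osserman argument: if the total crossing time [B] were
less than [r / 2], [M] would exceed every level on [0, r / 2], while a continuous
function is bounded on the ball. Halving the radius leaves room for the
Lipschitz estimate of [M]. *)
Lemma subsolution_radius (R : realType) n (Omega : set 'rV[R]_n) q f g u y (r s0 B : R) :
  0 < q < 2 -> admissible f g ->
  {within Omega, continuous u} -> viscosity_subsolution Omega (rhs q f g) u ->
  0 < r -> [set x | enorm (x - y) <= r] `<=` Omega -> 0 < u y -> 0 < s0 ->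
  (forall k, Num.sqrt (4 * s0 / f (u y)) + crossing_const q *
    \sum_(i < k) (s0 * 2 ^+ i / forced_slope q f g (u y) (s0 * 2 ^+ i)) <= B) ->
  r / 2 <= B.
Proof.
move=> q02 adm cu su r0 BO uy0 s00 HB; have /andP[q0 _] := q02.
have rg := ballmax_growth q0 adm cu su (ltW r0) BO uy0.
have r20 : 0 <= r / 2 by rewrite divr_ge0// ltW.
have r2r : r / 2 < r by lra.
have := upper_nthrootP (leqnn (Num.bound (ballmax u y (r / 2) / s0))).
rewrite ltr_pdivrMr// [ltRHS]mulrC; move: (Num.bound _) => k lek.
apply: le_trans (HB k); apply: (growth_radius q02 adm uy0 r20 r2r rg s00) => //.
move: lek => /ltW /le_trans; apply.
have : 0 < s0 * 2 ^+ k by rewrite mulr_gt0// exprn_gt0.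
by move: (s0 * 2 ^+ k) => z z0; lra.
Qed.

(** Forced slopes dominate [h]: with [x = s / (t + s)] each of the two terms
loses at most the factor [x ^ (1 / (2 - q))]. *)
Lemma hfun_le_forced_slope (R : realType) (q : R) (f g : R -> R) (t s : R) :
  0 < q < 2 -> admissible f g -> 0 < t -> 0 < s ->
  (s / (t + s)) `^ (2 - q)^-1 * ((t + s) * hfun q f g (t + s))
    <= forced_slope q f g t s.
Proof.
move=> /andP[q0 q2] adm t0 s0; set sg := t + s.
have sg0 : 0 < sg by rewrite addr_gt0.
have fs := admissible_f_gt0 adm sg0; have gs := admissible_g_ge0 adm sg0.
have x0 : 0 < s / sg by rewrite divr_gt0.
have x1 : s / sg <= 1 by rewrite ler_pdivrMr// mul1r lerDr ltW.
have xs : s / sg * sg = s by rewrite divfK// gt_eqF.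
have i0 : 2 - q != 0 by rewrite gt_eqF// subr_gt0.
have fE : sg * (f sg / sg) `^ 2^-1 = (f sg * sg) `^ 2^-1.
  have sgE : sg = (sg ^+ 2) `^ 2^-1.
    by rewrite -powR_mulrn ?(ltW sg0)// -powRrM mulfV// powRr1 ?(ltW sg0).
  rewrite {1}sgE -powRM ?sqr_ge0 ?divr_ge0 ?(ltW fs) ?(ltW sg0)//.
  by congr (_ `^ _); field; rewrite gt_eqF.
have gE : sg * (g sg / sg `^ (1 - q)) `^ (2 - q)^-1 = (g sg * sg) `^ (2 - q)^-1.
  have sgE : sg = (sg `^ (2 - q)) `^ (2 - q)^-1.
    by rewrite -powRrM mulfV// powRr1 ?(ltW sg0).
  rewrite {1}sgE -powRM ?powR_ge0 ?divr_ge0 ?powR_ge0//.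
  congr (_ `^ _); rewrite mulrCA -powRB ?(gt_eqF sg0) ?implybT//.
  by rewrite (_ : 2 - q - (1 - q) = 1) ?powRr1 ?(ltW sg0)//; ring.
rewrite /hfun mulrDr fE gE mulrDr /forced_slope -/sg lerD//.
  have -> : f sg * s = s / sg * (f sg * sg) by rewrite mulrCA xs.
  rewrite (powRM _ (ltW x0) (mulr_ge0 (ltW fs) (ltW sg0))).
  rewrite ler_wpM2r ?powR_ge0// ger_powR ?x0//.
  by rewrite lef_pV2 ?posrE//; lra.
have -> : g sg * s = s / sg * (g sg * sg) by rewrite mulrCA xs.
by rewrite (powRM _ (ltW x0) (mulr_ge0 gs (ltW sg0))).
Qed.

Lemma hfun_gt0 (R : realType) (q : R) (f g : R -> R) (t : R) :
  admissible f g -> 0 < t -> 0 < hfun q f g t.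
Proof.
move=> adm t0; rewrite ltr_wpDr ?powR_ge0// powR_gt0// divr_gt0//.
exact: admissible_f_gt0 adm t0.
Qed.

(** The exponent is [|i - N|], written with truncated subtractions. *)
Lemma two_sided_geometric (R : realType) (th : R) (N k : nat) : 0 < th < 1 ->
  \sum_(i < k) th ^+ ((i - N) + (N - i)) <= 2 / (1 - th).
Proof.
move=> /andP[th0 th1]; have d0 : 0 < 1 - th by rewrite subr_gt0.
rewrite ler_pdivlMr//.
have left_part j : (j <= N)%N ->
    (\sum_(i < j) th ^+ ((i - N) + (N - i))) * (1 - th) <= th ^+ (N - j).
  elim: j => [|j IH] jN; first by rewrite big_ord0 mul0r exprn_ge0// ltW.
  rewrite big_ord_recr /= mulrDl.
  have := IH (ltnW jN); rewrite (eqP (ltnW jN : _ == _)) add0n.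
  rewrite -(subnSK jN) exprS; set w := th ^+ (N - j.+1).
  have w0 : 0 <= w by rewrite exprn_ge0// ltW.
  by have : 0 <= w * (1 - th) ^+ 2; [rewrite mulr_ge0// sqr_ge0 | nra].
have right_part j :
    (\sum_(i < N + j) th ^+ ((i - N) + (N - i))) * (1 - th) <= 2 - th ^+ j.
  elim: j => [|j IH].
    by rewrite addn0 (le_trans (left_part N (leqnn N)))// subnn expr0; lra.
  rewrite addnS big_ord_recr /= mulrDl addKn.
  rewrite (eqP (leq_addr j N : (N - (N + j) == 0)%N)) addn0 exprS.
  by set w := th ^+ j in IH *; lra.
have [kN|Nk] := leqP k N.
  have : th ^+ (N - k) <= 1 by rewrite exprn_ile1// ltW.
  by have := left_part k kN; lra.
rewrite -(subnKC (ltnW Nk)) (le_trans (right_part _))//.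
by rewrite gerBl exprn_ge0// ltW.
Qed.

(** * A priori bound under power growth of h *)

Lemma powR_le1 (R : realType) (x a : R) : 0 <= x <= 1 -> 0 <= a -> x `^ a <= 1.
Proof.
move=> /andP[x0 x1] a0; rewrite -[leRHS](_ : 1 `^ a = 1); last by rewrite powR1.
by rewrite ge0_ler_powR ?nnegrE.
Qed.

(** The exponent [1 - 1 / (2 - q) = (1 - q) / (2 - q)] governs levels close to
[t], and [nu] the levels far above it. *)
Definition decay_rate (R : realType) (q nu : R) : R :=
  2^-1 `^ Num.min (1 - (2 - q)^-1) nu.

Lemma decay_rate_itv (R : realType) (q nu : R) : 0 < q < 1 -> 0 < nu ->
  0 < decay_rate q nu < 1.
Proof.
move=> /andP[q0 q1] nu0; rewrite powR_gt0//=.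
rewrite -[ltRHS](_ : 1 `^ Num.min (1 - (2 - q)^-1) nu = 1); last by rewrite powR1.
rewrite gt0_ltr_powR ?nnegrE//; last by lra.
by rewrite lt_min nu0 subr_gt0 invf_lt1; lra.
Qed.

(** With [z = s / t] the left-hand side is, up to a constant, the crossing time
of the level [t + s]. For small [z] the first factor is small because [q < 1];
for large [z] the second one, which comes from the power growth of [h]. *)
Lemma crossing_decay (R : realType) (q nu z : R) j : 0 < q < 1 -> 0 < nu ->
  z = 2^-1 ^+ j \/ z = 2 ^+ j ->
  (z / (1 + z)) `^ (1 - (2 - q)^-1) * ((1 + z)^-1) `^ nu <= decay_rate q nu ^+ j.
Proof.
move=> /andP[q0 q1] nu0 zE; set om := 1 - _.
have om0 : 0 < om by rewrite subr_gt0 invf_lt1; lra.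
pose w : R := 2^-1 ^+ j.
have w0 : 0 < w by rewrite exprn_gt0.
have w1 : w <= 1 by rewrite exprn_ile1//; lra.
have -> : decay_rate q nu ^+ j = w `^ Num.min om nu.
  by rewrite /decay_rate -powR_mulrn ?powR_ge0// powRAC powR_mulrn.
have z0 : 0 < z by case: zE => ->; rewrite exprn_gt0.
have x01 : 0 <= z / (1 + z) <= 1.
  rewrite divr_ge0 ?addr_ge0 ?(ltW z0)//= ler_pdivrMr ?mul1r ?addr_gt0//; lra.
have y01 : 0 <= (1 + z)^-1 <= 1.
  by rewrite invr_ge0 addr_ge0 ?(ltW z0)//= invf_le1 ?addr_gt0//; lra.
have wle a : Num.min om nu <= a -> w `^ a <= w `^ Num.min om nu.
  by move=> ?; rewrite ger_powR// w0.
have zz : z / (1 + z) <= z /\ (1 + z)^-1 <= z^-1.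
  split; last by rewrite lef_pV2 ?posrE ?addr_gt0//; lra.
  by rewrite ler_pdivrMr ?addr_gt0// ler_peMr ?(ltW z0)//; lra.
case: zE => zE.
  apply: (@le_trans _ _ (w `^ om)); last by rewrite wle// ge_min lexx.
  rewrite -[leRHS]mulr1 ler_pM ?powR_ge0//; last by rewrite powR_le1// ltW.
  rewrite ge0_ler_powR ?nnegrE ?(ltW om0) ?(ltW w0)//; first by case/andP: x01.
  by rewrite /w -zE; exact: zz.1.
apply: (@le_trans _ _ (w `^ nu)); last by rewrite wle// ge_min lexx orbT.
rewrite -[leRHS]mul1r ler_pM ?powR_ge0//; first by rewrite powR_le1// ltW.
rewrite ge0_ler_powR ?nnegrE ?(ltW nu0) ?(ltW w0)//; first by case/andP: y01.
by rewrite /w exprVn -zE; exact: zz.2.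
Qed.

(** The factor [2 / (1 - decay_rate q nu)] bounds the two geometric series of
crossing times, and the outer [2] accounts for halving the radius. *)
Definition power_radius_const (R : realType) (q nu rho : R) : R :=
  2 * (crossing_const q / rho * (2 / (1 - decay_rate q nu))).

(** The levels start at [s0 = t 2^-N], so small that the time spent near the
centre is negligible; the sum of the other crossing times is a two-sided
geometric series whose bound does not depend on [N]. *)
Lemma subsolution_radius_power (R : realType) n (Omega : set 'rV[R]_n) q nu rho f g u y (r : R) :
  0 < q < 1 -> 0 < nu -> 0 < rho < 1 -> admissible f g ->
  (forall s t : R, 0 < t -> t <= s ->
            rho * (hfun q f g t / t `^ nu) <= hfun q f g s / s `^ nu) ->
  {within Omega, continuous u} -> viscosity_subsolution Omega (rhs q f g) u ->
  0 < r -> [set x | enorm (x - y) <= r] `<=` Omega -> 0 < u y ->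
  r * hfun q f g (u y) <= power_radius_const q nu rho.
Proof.
move=> q01 nu0 /andP[rho0 rho1] adm hyp cu su r0 BO t0.
have /andP[q0 q1] := q01; set t := u y in t0 *.
have q02 : 0 < q < 2 by rewrite q0; lra.
have /andP[th0 th1] := decay_rate_itv q01 nu0.
have ht := hfun_gt0 q adm t0; have ft := admissible_f_gt0 adm t0.
have K0 : 0 < crossing_const q by rewrite crossing_const_gt0//; lra.
suff rB : r / 2 <= crossing_const q *
    ((rho * hfun q f g t)^-1 * (2 / (1 - decay_rate q nu))).
  rewrite -ler_pdivlMr// /power_radius_const.
  have -> : 2 * (crossing_const q / rho * (2 / (1 - decay_rate q nu))) / hfun q f g t
      = crossing_const q *
          ((rho * hfun q f g t)^-1 * (2 / (1 - decay_rate q nu))) * 2.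
    by rewrite invfM; ring.
  by rewrite -ler_pdivrMr.
apply/ler_addgt0Pr => e e0.
have := upper_nthrootP (leqnn (Num.bound (4 * t / f t / e ^+ 2))).
set N := Num.bound _; rewrite ltr_pdivrMr ?exprn_gt0// => ltN.
have s00 : 0 < t * 2^-1 ^+ N by rewrite mulr_gt0// exprn_gt0.
apply: (subsolution_radius q02 adm cu su r0 BO t0 s00) => k; rewrite -/t addrC.
rewrite lerD//; last first.
  rewrite -[leRHS]ger0_norm ?(ltW e0)// -sqrtr_sqr ler_wsqrtr//.
  rewrite mulrA mulrAC exprVn ler_pdivrMr ?exprn_gt0//.
  by rewrite mulrC (mulrC 4) ltW// -mulrA; move: ltN; lra.
rewrite ler_wpM2l ?(ltW K0)//.
apply: (@le_trans _ _ (\sum_(i < k) (rho * hfun q f g t)^-1 *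
    decay_rate q nu ^+ ((i - N) + (N - i)))).
  apply: ler_sum => i _.
  set s := _ * 2 ^+ i; have s0 : 0 < s by rewrite mulr_gt0// exprn_gt0.
  pose z := s / t; have z0 : 0 < z by rewrite divr_gt0.
  have zt : s = z * t by rewrite /z divfK// gt_eqF.
  have zE : z = 2^-1 ^+ ((i - N) + (N - i)) \/ z = 2 ^+ ((i - N) + (N - i)).
    have zE : z = 2^-1 ^+ N * 2 ^+ i.
      by rewrite /z /s; field; rewrite gt_eqF.
    have [iN|Ni] := leqP i N; [left|right].
      rewrite (eqP iN) add0n zE -{1}(subnK iN) exprD -mulrA -exprMn.
      by rewrite mulVf// expr1n mulr1.
    rewrite (eqP (ltnW Ni)) addn0 zE -{1}(subnKC (ltnW Ni)) exprD mulrA -exprMn.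
    by rewrite mulVf// expr1n mul1r.
  apply: le_trans (ler_wpM2l _ (crossing_decay q01 nu0 zE)); last first.
    by rewrite invr_ge0 ltW// mulr_gt0.
  set sg := t + s; have sg0 : 0 < sg by rewrite addr_gt0.
  have hs := hfun_gt0 q adm sg0.
  have W0 := forced_slope_gt0 q adm t0 s0.
  have zx : z / (1 + z) = s / sg.
    by rewrite /sg zt; field; rewrite !gt_eqF ?addr_gt0// mulr_gt0// addr_gt0.
  have zy : (1 + z)^-1 = t / sg.
    by rewrite /sg zt; field; rewrite !gt_eqF ?addr_gt0// mulr_gt0// addr_gt0.
  rewrite zx zy.
  have hle : rho * hfun q f g t <= hfun q f g sg * (t / sg) `^ nu.
    have := hyp sg t t0; rewrite lerDl (ltW s0) => /(_ isT).
    rewrite mulrA ler_pdivrMr ?powR_gt0// => /le_trans; apply.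
    rewrite powRM ?invr_ge0 ?(ltW t0) ?(ltW sg0)//.
    rewrite -[sg^-1]powR_inv1 ?(ltW sg0)// -powRrM mulN1r powRN.
    by rewrite mulrAC -mulrA.
  rewrite (ler_pdivlMl _ _ (mulr_gt0 rho0 ht)).
  rewrite mulrA (ler_pdivrMr _ _ W0).
  have x0 : 0 < s / sg by rewrite divr_gt0.
  have xE : (s / sg) `^ (1 - (2 - q)^-1) * (s / sg) `^ (2 - q)^-1 = s / sg.
    by rewrite -powRD ?(gt_eqF x0) ?implybT// subrK powRr1 ?(ltW x0).
  have := hfun_le_forced_slope q02 adm t0 s0; rewrite -/sg.
  move=> /(ler_wpM2l (mulr_ge0 (powR_ge0 (s / sg) (1 - (2 - q)^-1)) (powR_ge0 (t / sg) nu))).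
  apply: le_trans.
  have -> : (s / sg) `^ (1 - (2 - q)^-1) * (t / sg) `^ nu *
      ((s / sg) `^ (2 - q)^-1 * (sg * hfun q f g sg)) =
      s / sg * (t / sg) `^ nu * (sg * hfun q f g sg).
    by rewrite -[in RHS]xE; ring.
  have -> : s / sg * (t / sg) `^ nu * (sg * hfun q f g sg) =
     hfun q f g sg * (t / sg) `^ nu * s by field; rewrite gt_eqF.
  by rewrite ler_wpM2r ?(ltW s0).
rewrite -mulr_sumr.
apply: le_trans (ler_wpM2l _ (two_sided_geometric N k _)) _.
- by rewrite invr_ge0 ltW// mulr_gt0.
- by rewrite th0.
exact: lexx.
Qed.

(** * The Keller-Osserman integral and dyadic sums *)

(** The easy half of Cauchy condensation. *)
Lemma condensation_le_integral (R : realType) (Q : R -> R) (N : nat) :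
  (forall x, 0 <= Q x) -> nonincreasing_fun Q ->
  ((\sum_(k < N) 2 ^+ k * Q (2 ^+ k.+1))%:E <=
    \int[lebesgue_measure]_(s in `[1%R, +oo[) (Q s)%:E)%E.
Proof.
move=> Q0 Qni.
have p1 k : 1 <= 2 ^+ k :> R by rewrite exprn_ege1// ler1n.
apply: (@le_trans _ _ (\int[lebesgue_measure]_(s in `[1%R, (2 ^+ N)%R[) (Q s)%:E)%E);
  last first.
  apply: ge0_subset_integral => //.
    by apply/measurable_EFinP; apply: (@nonincreasing_measurable R _ Q) => //.
    by move=> x _; rewrite lee_fin.
  by move=> x /=; rewrite !in_itv /= => /andP[->].
elim: N => [|N IH].
  by rewrite big_ord0; apply: integral_ge0 => x _; rewrite lee_fin.
rewrite big_ord_recr /= EFinD.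
have -> : `[1, 2 ^+ N.+1[%classic = `[1, 2 ^+ N[%classic `|` `[2 ^+ N, 2 ^+ N.+1[%classic :> set R.
  apply/seteqP; split=> x /=; rewrite !in_itv /=.
    move=> /andP[x1 xN]; have [xlt|xge] := ltP x (2 ^+ N); first by left; rewrite x1.
    by right; rewrite xN.
  case=> /andP[x1 xN].
    by rewrite x1 (lt_le_trans xN)// exprS ler_peMl ?ler1n// exprn_ge0.
  by rewrite xN (le_trans (p1 N)).
rewrite ge0_integral_setU//; first last.
- rewrite disj_set2E; apply/eqP/seteqP; split=> x //=; rewrite !in_itv /=.
  by move=> [/andP[_ x1] /andP[x2 _]]; move: (lt_le_trans x1 x2); rewrite ltxx.
- by move=> x _; rewrite lee_fin.
- apply/measurable_EFinP; apply: (@nonincreasing_measurable R _ Q) => //.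
  exact: measurableU.
apply: leeD IH _.
apply: (@le_trans _ _ (\int[lebesgue_measure]_(s in `[(2 ^+ N)%R, (2 ^+ N.+1)%R[)
   (cst (Q (2 ^+ N.+1))%:E) s)%E).
  rewrite integral_cst//= lebesgue_measure_itv /= lte_fin exprS ltr_pMl ?exprn_gt0//.
  rewrite ltr1n /= -EFinD -EFinM lee_fin mulrC ler_wpM2l//.
  by rewrite -exprS exprS; lra.
apply: ge0_le_integral => //.
- by move=> x _; rewrite lee_fin.
- by apply/measurable_EFinP; apply: (@nonincreasing_measurable R _ Q) => //.
- move=> x /=; rewrite in_itv /= => /andP[_ xN].
  by rewrite lee_fin Qni// ltW.
Qed.

Section Primitive.
Variables (R : realType) (f : R -> R).
Hypotheses (hf : {homo f : x y / x <= y}) (cf : continuous f) (f0 : 0 <= f 0).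

Let integrable_f (a b : R) :
  lebesgue_measure.-integrable `[a, b] (EFin \o f).
Proof.
by apply: continuous_compact_integrable;
  [exact: segment_compact|exact: continuous_subspaceT].
Qed.

Let f_ge0 x : 0 <= x -> 0 <= f x.
Proof. by move=> x0; exact: le_trans (hf x0). Qed.

Lemma primitive_ge0 s : 0 <= primitive f s.
Proof.
by apply: Rintegral_ge0 => x /=; rewrite in_itv /= => /andP[x0 _]; exact: f_ge0.
Qed.

Lemma primitive_le s : 0 <= s -> primitive f s <= s * f s.
Proof.
move=> s0; have -> : s * f s = Rintegral lebesgue_measure `[0, s] (cst (f s)).
  rewrite Rintegral_cst//= lebesgue_measure_itv /= lte_fin.
  move: s0; rewrite le_eqVlt => /predU1P[<-|s0]; first by rewrite ltxx mul0r mulr0.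
  by rewrite s0 /= oppr0 addr0 mulrC.
apply: le_Rintegral => //.
- by apply: continuous_compact_integrable; [exact: segment_compact|
    apply: continuous_subspaceT; exact: cst_continuous].
- by move=> x /=; rewrite in_itv /= => /andP[_ /hf].
Qed.

Lemma primitive_split a b : 0 <= a -> a <= b ->
  primitive f a + (b - a) * f a <= primitive f b.
Proof.
move=> a0; rewrite le_eqVlt => /predU1P[<-|ab]; first by rewrite subrr mul0r addr0.
have ab' : [disjoint `[0, a]%classic & `]a, b]%classic].
  rewrite disj_set2E; apply/eqP/seteqP; split=> x //=; rewrite !in_itv /=.
  by move=> [/andP[_ x1] /andP[x2 _]]; move: (lt_le_trans x2 x1); rewrite ltxx.
have abE : `[0, b]%classic = `[0, a]%classic `|` `]a, b]%classic.
  apply/seteqP; split=> x /=; rewrite !in_itv /=.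
    move=> /andP[x0 xb]; have [xa|ax] := leP x a; first by left; rewrite x0.
    by right; rewrite xb.
  case=> /andP[h1 h2]; first by rewrite h1 (le_trans h2)// ltW.
  by rewrite h2 andbT (le_trans a0)// ltW.
have iU : lebesgue_measure.-integrable (`[0, a] `|` `]a, b]) (EFin \o f).
  by rewrite -abE.
have iab : lebesgue_measure.-integrable `]a, b] (EFin \o f).
  apply: integrableS iU => //; first exact: measurableU.
have -> : (b - a) * f a = Rintegral lebesgue_measure `]a, b] (cst (f a)).
  by rewrite Rintegral_cst//= lebesgue_measure_itv /= lte_fin ab /= mulrC.
rewrite /primitive abE Rintegral_setU// lerD2l; apply: le_Rintegral => //.
- have ic : lebesgue_measure.-integrable `[a, b] (EFin \o cst (f a)).
    by apply: continuous_compact_integrable; [exact: segment_compact|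
      apply: continuous_subspaceT; exact: cst_continuous].
  apply: integrableS ic => //.
  by move=> x /=; rewrite !in_itv /= => /andP[/ltW -> ->].
- by move=> x /=; rewrite in_itv /= => /andP[/ltW /hf].
Qed.

Lemma primitive_homo : {homo primitive f : a b / a <= b}.
Proof.
move=> a b ab; have [a0|a0] := leP 0 a.
  apply: le_trans (primitive_split a0 ab).
  by rewrite lerDl mulr_ge0 ?subr_ge0// f_ge0.
rewrite (_ : primitive f a = 0) ?primitive_ge0//.
by rewrite /primitive set_itv_ge ?Rintegral_set0// bnd_simp -ltNge.
Qed.

Lemma primitive_gt0 s : 0 < s -> 0 < f (s / 2) -> 0 < primitive f s.
Proof.
move=> s0 fs; have s2 : 0 <= s / 2 by rewrite divr_ge0// ltW.
have ss : s / 2 <= s by lra.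
apply: lt_le_trans (primitive_split s2 ss).
by rewrite ltr_wpDl ?primitive_ge0// mulr_gt0//; lra.
Qed.

End Primitive.

Definition ko_slope (R : realType) (q : R) (f g : R -> R) (s : R) : R :=
  Num.sqrt (primitive f s) + primitive g s `^ (2 - q)^-1.

Section KoSlope.
Variables (R : realType) (q : R) (f g : R -> R).
Hypotheses (q2 : q < 2) (adm : admissible f g).

Let hf : {homo f : x y / x <= y}. Proof. exact: (admissible_homo adm).1. Qed.
Let hg : {homo g : x y / x <= y}. Proof. exact: (admissible_homo adm).2. Qed.
Let cf : continuous f. Proof. by case: adm => _ []. Qed.
Let cg : continuous g. Proof. by case: adm => _ []. Qed.
Let i0 : 0 <= (2 - q)^-1. Proof. by rewrite invr_ge0 subr_ge0 ltW. Qed.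

Lemma ge0_at0 (p : R -> R) : continuous p -> (forall t, 0 < t -> 0 <= p t) -> 0 <= p 0.
Proof.
move=> cp p0; rewrite leNgt; apply/negP => p00.
have /nbhs_ballP[e /= e0] : nbhs (0 : R) [set t | p t < 0].
  exact: cvgr_lt (p 0) (cp 0) 0 p00.
move=> /(_ (e / 2)); rewrite /ball /= sub0r normrN.
rewrite gtr0_norm ?divr_gt0//; have -> : e / 2 < e by lra.
by move=> /(_ isT); apply/negP; rewrite -leNgt p0// divr_gt0.
Qed.

Let f00 : 0 <= f 0.
Proof. by apply: ge0_at0 => // t t0; rewrite ltW// (admissible_f_gt0 adm). Qed.
Let g00 : 0 <= g 0.
Proof. by apply: ge0_at0 => // t t0; rewrite (admissible_g_ge0 adm). Qed.

Lemma ko_slope_gt0 s : 0 < s -> 0 < ko_slope q f g s.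
Proof.
move=> s0; rewrite ltr_wpDr ?powR_ge0// sqrtr_gt0 primitive_gt0//.
by rewrite (admissible_f_gt0 adm)// divr_gt0.
Qed.

Lemma ko_slope_homo : {homo ko_slope q f g : a b / a <= b}.
Proof.
move=> a b ab; apply: lerD; first by apply: ler_wsqrtr; exact: primitive_homo.
apply: ge0_ler_powR; first exact: i0.
- by rewrite nnegrE; exact: primitive_ge0.
- by rewrite nnegrE; exact: primitive_ge0.
- exact: primitive_homo.
Qed.

(** Monotonicity gives [primitive f s <= s f s <= s f (t + s)]. *)
Lemma ko_slope_le_forced t s : 0 < t -> 0 < s -> ko_slope q f g s <= forced_slope q f g t s.
Proof.
move=> t0 s0; have ts : s <= t + s by rewrite lerDr ltW.
have mono (p : R -> R) : {homo p : x y / x <= y} -> continuous p -> 0 <= p 0 ->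
    primitive p s <= p (t + s) * s.
  move=> hp cp p0; rewrite (le_trans (primitive_le hp cp (ltW s0)))// mulrC.
  by rewrite ler_wpM2r ?(ltW s0)// hp.
have Ff := mono f hf cf f00; have Fg := mono g hg cg g00.
apply: lerD.
  rewrite powR12_sqrt; first exact: ler_wsqrtr.
  by apply: le_trans Ff; exact: primitive_ge0.
apply: ge0_ler_powR; first exact: i0.
- by rewrite nnegrE; exact: primitive_ge0.
- by rewrite nnegrE; apply: le_trans Fg; exact: primitive_ge0.
- exact: Fg.
Qed.

(** The integrand is decreasing, so its integral dominates the dyadic sums. *)
Lemma ko_sum_bounded : integral_condition q f g ->
  exists I : R, forall N, \sum_(k < N) 2 ^+ k / ko_slope q f g (2 ^+ k.+1) <= I.
Proof.
rewrite /integral_condition => ic.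
(* Freezing the integrand below [1] makes it decreasing on the whole line: at
[s <= 0] the primitives, hence the inverse, take the value 0. *)
pose Q s := (ko_slope q f g (Num.max s 1))^-1.
have m1 s : 0 < Num.max s 1 :> R by rewrite lt_max ltr01 orbT.
have Q0 s : 0 <= Q s by rewrite invr_ge0 ltW// ko_slope_gt0.
have Qni : nonincreasing_fun Q.
  move=> x y xy; have xy1 : Num.max x 1 <= Num.max y 1.
    by rewrite ge_max !le_max xy lexx orbT.
  have := ko_slope_homo xy1; rewrite /Q.
  by rewrite lef_pV2 ?posrE; [| exact: ko_slope_gt0 | exact: ko_slope_gt0].
have QE : (\int[lebesgue_measure]_(s in `[1%R, +oo[) (Q s)%:E < +oo)%E.
  suff <- : (\int[lebesgue_measure]_(s in `[1%R, +oo[) ((ko_slope q f g s)^-1)%:E =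
      \int[lebesgue_measure]_(s in `[1%R, +oo[) (Q s)%:E)%E by exact: ic.
  by apply: eq_integral => s; rewrite inE /= in_itv /= andbT => s1; rewrite /Q max_l.
exists (fine (\int[lebesgue_measure]_(s in `[1%R, +oo[) (Q s)%:E)) => N.
rewrite -lee_fin fineK; last first.
  by rewrite ge0_fin_numE// integral_ge0// => x _; rewrite lee_fin.
apply: le_trans (condensation_le_integral N Q0 Qni).
rewrite lee_fin le_eqVlt; apply/orP; left; apply/eqP; apply: eq_bigr => k _.
by rewrite /Q max_l// exprn_ege1// ler1n.
Qed.

End KoSlope.

(** * A priori bound under the integral condition *)

Lemma bounded_sum_tail (R : realType) (a : nat -> R) (I e : R) :
  (forall N, \sum_(k < N) a k <= I) -> 0 < e ->
  exists K, forall N, \sum_(k < N) a (K + k)%N <= e.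
Proof.
move=> aI e0; pose S := [set \sum_(k < N) a k | N in [set: nat]].
have hS : has_sup S.
  split; first by exists (\sum_(k < 0) a k), 0%N.
  by exists I => _ [N _ <-].
have [_ [K _ <-] ltK] := sup_adherent e0 hS.
exists K => N; have : \sum_(k < K + N) a k <= sup S.
  by apply: (ub_le_sup hS.2); exists (K + N)%N.
rewrite big_split_ord /=.
by move: (\sum_(i < N) _) (\sum_(i < K) a i) ltK => x z; lra.
Qed.

Definition unbounded_above (R : realType) (p : R -> R) : Prop :=
  forall A, exists T, A <= p T.

Lemma cvgy_unbounded (R : realType) (p : R -> R) :
  p t @[t --> +oo] --> +oo -> unbounded_above p.
Proof.
move=> /cvgryPge cp A; have [M [_ MP]] := cp A.
by exists (M + 1); apply: MP; rewrite ltrDl.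
Qed.

Section LargeValues.
Variables (R : realType) (q : R) (f g : R -> R).
Hypotheses (q02 : 0 < q < 2) (adm : admissible f g).
Hypothesis unb : unbounded_above f \/ unbounded_above g.

Let hf : {homo f : x y / x <= y}. Proof. exact: (admissible_homo adm).1. Qed.
Let hg : {homo g : x y / x <= y}. Proof. exact: (admissible_homo adm).2. Qed.
Let q2 : q < 2. Proof. by case/andP: q02. Qed.

Lemma crossing_time_to0 s e : 0 < s -> 0 < e ->
  exists2 T, 1 <= T & forall t, T <= t -> s / forced_slope q f g t s <= e.
Proof.
move=> s0 e0; pose A := s / e; have A0 : 0 < A by rewrite divr_gt0.
have p2 : 0 < 2 - q by rewrite subr_gt0.
suff [T WT] : exists T, forall t, 1 <= t -> T <= t -> A <= forced_slope q f g t s.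
  exists (Num.max T 1); first by rewrite le_max lexx orbT.
  move=> t; rewrite ge_max => /andP[Tt t1].
  have W0 : 0 < forced_slope q f g t s.
    by rewrite forced_slope_gt0// (lt_le_trans ltr01).
  by rewrite ler_pdivrMr// mulrC -ler_pdivrMr// WT.
case: unb => [/(_ (A ^+ 2 / s))|/(_ (A `^ (2 - q) / s))] [T AT]; exists T => t t1 Tt.
  have : A ^+ 2 <= f (t + s) * s.
    by rewrite -ler_pdivrMr// (le_trans AT)// hf// (le_trans Tt)// lerDl ltW.
  rewrite /forced_slope => As; apply: (@le_trans _ _ ((f (t + s) * s) `^ 2^-1)).
    have fs : 0 <= f (t + s) * s by rewrite (le_trans _ As)// sqr_ge0.
    rewrite powR12_sqrt// -[leLHS](ger0_norm (ltW A0)) -sqrtr_sqr.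
    exact: ler_wsqrtr.
  by rewrite lerDl powR_ge0.
have As : A `^ (2 - q) <= g (t + s) * s.
  by rewrite -ler_pdivrMr// (le_trans AT)// hg// (le_trans Tt)// lerDl ltW.
rewrite /forced_slope; apply: (@le_trans _ _ ((g (t + s) * s) `^ (2 - q)^-1)).
  have -> : A = (A `^ (2 - q)) `^ (2 - q)^-1.
    by rewrite -powRrM mulfV ?(lt0r_neq0 p2)// powRr1// ltW.
  rewrite ge0_ler_powR ?nnegrE ?powR_ge0 ?invr_ge0 ?(ltW p2)//.
  by rewrite (le_trans _ As)// powR_ge0.
by rewrite lerDr powR_ge0.
Qed.

Lemma finite_crossing_to0 (s : nat -> R) e L : (forall i, 0 < s i) -> 0 < e ->
  exists2 T, 1 <= T & forall t, T <= t ->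
    \sum_(i < L) s i / forced_slope q f g t (s i) <= e.
Proof.
move=> s0; elim: L e => [|L IH] e e0.
  by exists 1 => // t _; rewrite big_ord0 ltW.
have e2 : 0 < e / 2 by rewrite divr_gt0.
have [T1 T11 P1] := IH _ e2; have [T2 T21 P2] := crossing_time_to0 (s0 L) e2.
exists (Num.max T1 T2); first by rewrite le_max T11.
move=> t; rewrite ge_max => /andP[/P1 h1 /P2 h2].
by rewrite big_ord_recr /=; lra.
Qed.

(** For large [t] the blow-up time is small: the levels far above [t] are
handled by the tail of the integral, the finitely many remaining ones by the
divergence of [f] or [g]. *)
Lemma blowup_time_to0 e : integral_condition q f g -> 0 < e ->
  exists2 T, 1 <= T & forall t, T <= t -> exists2 s0, 0 < s0 & forall k,
    Num.sqrt (4 * s0 / f t) + crossing_const q *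
    \sum_(i < k) (s0 * 2 ^+ i / forced_slope q f g t (s0 * 2 ^+ i)) <= e.
Proof.
move=> /(ko_sum_bounded q2 adm)[I HI] e0.
have C0 := crossing_const_gt0 q2; set C := crossing_const q in C0 *.
have f1 : 0 < f 1 := admissible_f_gt0 adm ltr01.
have e3 : 0 < e / 3 by rewrite divr_gt0.
have [K HK] := @bounded_sum_tail R (fun k => 2 ^+ k / ko_slope q f g (2 ^+ k.+1))
  I _ HI (divr_gt0 (divr_gt0 e3 C0) (ltr0n R 2)).
have [m ltm] : exists m, 4 / f 1 / (e / 3) ^+ 2 < 2 ^+ m.
  by eexists; exact: upper_nthrootP (leqnn _).
pose s0 : R := 2^-1 ^+ m; have s00 : 0 < s0 by rewrite exprn_gt0.
have si0 i : 0 < s0 * 2 ^+ i by rewrite mulr_gt0// exprn_gt0.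
pose L := (m + K.+1)%N.
have [T T1 HT] := @finite_crossing_to0 (fun i => s0 * 2 ^+ i) _ L si0 (divr_gt0 e3 C0).
exists T => // t Tt; exists s0 => // k.
have t1 : 1 <= t := le_trans T1 Tt; have t0 : 0 < t := lt_le_trans ltr01 t1.
have center : Num.sqrt (4 * s0 / f t) <= e / 3.
  rewrite -[leRHS](ger0_norm (ltW e3)) -sqrtr_sqr ler_wsqrtr//.
  apply: (@le_trans _ _ (4 * s0 / f 1)).
    rewrite ler_wpM2l ?mulr_ge0 ?(ltW s00)// lef_pV2 ?posrE ?(admissible_f_gt0 adm)//.
    exact: hf.
  rewrite /s0 exprVn mulrAC ler_pdivrMr ?exprn_gt0// [leRHS]mulrC -ler_pdivrMr ?exprn_gt0//.
  exact: ltW.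
pose b i := s0 * 2 ^+ i / forced_slope q f g t (s0 * 2 ^+ i).
have b0 i : 0 <= b i by rewrite divr_ge0 ?ltW// forced_slope_gt0.
have bL : \sum_(i < k) b i <= \sum_(i < L + k) b i.
  rewrite addnC big_split_ord /= lerDl; apply: sumr_ge0 => i _; exact: b0.
have tail : \sum_(i < k) b (L + i)%N <= 2 * \sum_(i < k) (2 ^+ (K + i) / ko_slope q f g (2 ^+ (K + i).+1)).
  rewrite mulr_sumr; apply: ler_sum => i _; rewrite /b.
  have -> : s0 * 2 ^+ (L + i) = 2 ^+ (K + i).+1.
    rewrite /L /s0 -addnA exprD mulrA -exprMn mulVf ?pnatr_eq0// expr1n mul1r.
    by rewrite addSn.
  rewrite mulrA -exprS ler_wpM2l ?exprn_ge0//.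
  have p0 : 0 < 2 ^+ (K + i).+1 :> R by rewrite exprn_gt0.
  by rewrite lef_pV2 ?posrE ?ko_slope_gt0 ?forced_slope_gt0// ko_slope_le_forced.
have tailE : \sum_(i < k) b (L + i)%N <= e / 3 / C.
  by apply: le_trans tail _; move: (HK k); lra.
have bsum : \sum_(i < k) b i <= 2 * (e / 3 / C).
  apply: (le_trans bL); rewrite big_split_ord /= mulr_natl mulr2n lerD//.
  exact: HT.
have : C * \sum_(i < k) b i <= 2 * (e / 3).
  have -> : 2 * (e / 3) = C * (2 * (e / 3 / C)) by field; rewrite gt_eqF.
  by rewrite ler_wpM2l ?(ltW C0).
by rewrite -/(b _); move: center; lra.
Qed.

(** A value above [T] at [y] would force a blow-up within [r / 4], against
[subsolution_radius]. *)
Lemma subsolution_bound r : integral_condition q f g -> 0 < r ->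
  exists2 T, 0 < T & forall n (Omega : set 'rV[R]_n) u y,
    {within Omega, continuous u} -> viscosity_subsolution Omega (rhs q f g) u ->
    [set x | enorm (x - y) <= r] `<=` Omega -> u y <= T.
Proof.
move=> ic r0; have r4 : 0 < r / 4 by rewrite divr_gt0.
have [T T1 HT] := blowup_time_to0 ic r4.
exists T; first exact: lt_le_trans ltr01 T1.
move=> n Omega u y cu su BO; rewrite leNgt; apply/negP => Tu.
have [s0 s00 Hs] := HT _ (ltW Tu).
have uy0 : 0 < u y := lt_trans (lt_le_trans ltr01 T1) Tu.
have := @subsolution_radius R n Omega q f g u y r s0 (r / 4) q02 adm cu su r0 BO uy0 s00 Hs.
lra.
Qed.

End LargeValues.

(** If [f] and [g] were both bounded, the integrand would be at least a multiple
of [1 / s] when [q = 1]. *)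
Lemma integral_condition_unbounded (R : realType) (f g : R -> R) :
  admissible f g -> integral_condition 1 f g ->
  unbounded_above f \/ unbounded_above g.
Proof.
move=> adm ic; apply: contrapT => /not_orP[/existsNP[A fA] /existsNP[B gB]].
have q2 : 1 < 2 :> R by rewrite ltr1n.
have [I HI] := ko_sum_bounded q2 adm ic.
have ltA x : f x <= A by rewrite leNgt; apply/negP => /ltW Ax; apply: fA; exists x.
have ltB x : g x <= B by rewrite leNgt; apply/negP => /ltW Bx; apply: gB; exists x.
have A0 : 0 < A := lt_le_trans (admissible_f_gt0 adm ltr01) (ltA 1).
have B0 : 0 <= B := le_trans (admissible_g_ge0 adm ltr01) (ltB 1).
have s1 : (2 - 1)^-1 = 1 :> R by rewrite (_ : 2 - 1 = 1 :> R) ?invr1//; ring.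
have koB s : 1 <= s -> ko_slope 1 f g s <= (A + 1 + B) * s.
  move=> s1'; have s0 : 0 < s := lt_le_trans ltr01 s1'.
  apply: le_trans (ko_slope_le_forced q2 adm ltr01 s0) _.
  rewrite /forced_slope s1 mulrDl lerD//.
    rewrite powR12_sqrt ?mulr_ge0 ?(ltW s0) ?(ltW (admissible_f_gt0 adm _)) ?addr_gt0//.
    have As0 : 0 <= (A + 1) * s by rewrite mulr_ge0 ?(ltW s0)// addr_ge0// ltW.
    rewrite -[leRHS](ger0_norm As0) -sqrtr_sqr ler_wsqrtr//.
    apply: (@le_trans _ _ (A * s)); first by rewrite ler_wpM2r ?(ltW s0).
    rewrite expr2 mulrACA ler_pM ?(ltW A0) ?(ltW s0)//; first by nra.
    by rewrite ler_peMl// ltW.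
  rewrite powRr1 ?mulr_ge0 ?(ltW s0) ?(admissible_g_ge0 adm) ?addr_gt0//.
  by rewrite ler_wpM2r ?(ltW s0).
have K0 : 0 < A + 1 + B by rewrite ltr_wpDr// addr_gt0.
pose c := (2 * (A + 1 + B))^-1.
have c0 : 0 < c by rewrite invr_gt0 mulr_gt0.
have term k : c <= 2 ^+ k / ko_slope 1 f g (2 ^+ k.+1).
  have p0 : 0 < 2 ^+ k.+1 :> R by rewrite exprn_gt0.
  have p1 : 1 <= 2 ^+ k.+1 :> R by rewrite exprn_ege1// ler1n.
  rewrite ler_pdivlMr ?ko_slope_gt0// /c ler_pdivrMl ?mulr_gt0//.
  by have := koB _ p1; rewrite exprS mulrCA mulrA mulrAC.
have [N ltN] : exists N : nat, I / c < N%:R.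
  have I0 : 0 <= I by have := HI 0%N; rewrite big_ord0.
  by eexists; apply: archi_boundP; rewrite divr_ge0// ltW.
have : c * N%:R <= I.
  apply: le_trans (HI N); apply: (@le_trans _ _ (\sum_(k < N) c)).
    by rewrite sumr_const card_ord -[leRHS]mulr_natr.
  exact: ler_sum.
by apply/negP; rewrite -ltNge -ltr_pdivrMl// mulrC.
Qed.

(** * The local Harnack inequality *)

Lemma hfun_bounds (R : realType) (q : R) (f g : R -> R) (s H : R) :
  q < 2 -> admissible f g -> 0 < s -> hfun q f g s <= H ->
  f s <= H ^+ 2 * s /\ g s <= H `^ (2 - q) * s `^ (1 - q).
Proof.
move=> q2 adm s0 hH; have p2 : 0 < 2 - q by rewrite subr_gt0.
have fs := admissible_f_gt0 adm s0; have gs := admissible_g_ge0 adm s0.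
have H0 : 0 <= H by rewrite (le_trans _ hH)// addr_ge0 ?powR_ge0.
have p0 := powR_gt0 (1 - q) s0.
split.
  rewrite -ler_pdivrMr//; have fs0 : 0 <= f s / s by rewrite divr_ge0// ltW.
  rewrite -[leLHS]powRr1// -[X in _ `^ X](mulVf (_ : 2 != 0 :> R))// powRrM.
  rewrite -powR_mulrn// ge0_ler_powR ?nnegrE ?powR_ge0//.
  by rewrite (le_trans _ hH)// lerDl powR_ge0.
rewrite -ler_pdivrMr//; have gs0 : 0 <= g s / s `^ (1 - q) by rewrite divr_ge0// ltW.
rewrite -[leLHS]powRr1// -[X in _ `^ X](mulVf (lt0r_neq0 p2)) powRrM.
rewrite ge0_ler_powR ?nnegrE ?powR_ge0 ?(ltW p2)//.
by rewrite (le_trans _ hH)// lerDr powR_ge0.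
Qed.

(** The barrier is [a (1 - rho / r)^2] with [eta = 1 - rho / r]. By the definition
of [h] each term of the equation is at most a power of [H] times an expression
homogeneous of degree one in [a], so smallness of [H r] alone makes them lose
against the second derivative [2 a / r^2]. *)
Lemma barrier_strict (R : realType) (q : R) (f g : R -> R) (a r eta H : R) :
  0 < q < 2 -> admissible f g -> 0 < a -> 0 < r -> 0 < eta <= 1 ->
  hfun q f g (a * eta ^+ 2) <= H -> (H * r) `^ (2 - q) <= 8^-1 ->
  f (a * eta ^+ 2) + g (a * eta ^+ 2) * (2 * a * eta / r) `^ q < 2 * a / r ^+ 2.
Proof.
move=> /andP[q0 q2] adm a0 r0 /andP[e0 e1]; set A := a * eta ^+ 2 => hH Hr.
have A0 : 0 < A by rewrite mulr_gt0// exprn_gt0.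
have [fA gA] := hfun_bounds q2 adm A0 hH.
have H0 : 0 <= H by rewrite (le_trans _ hH)// ltW// hfun_gt0.
have p2 : 0 < 2 - q by rewrite subr_gt0.
have Hr0 : 0 <= H * r by rewrite mulr_ge0// ltW.
have Hr1 : H * r <= 1.
  rewrite leNgt; apply/negP => Hr1; have : 1 <= (H * r) `^ (2 - q).
    rewrite -[leLHS](_ : 1 `^ (2 - q) = 1); last by rewrite powR1.
    by rewrite ge0_ler_powR ?nnegrE ?(ltW p2) ?(ltW Hr1).
  by move: Hr; lra.
have r2 : 0 < r ^+ 2 by rewrite exprn_gt0.
rewrite ltr_pdivlMr// mulrDl.
have e21 : eta ^+ 2 <= 1 by rewrite exprn_ile1// ltW.
have f_part : f A * r ^+ 2 <= a.
  apply: le_trans (ler_wpM2r (ltW r2) fA) _.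
  have -> : H ^+ 2 * A * r ^+ 2 = a * ((H * r) ^+ 2 * eta ^+ 2) by rewrite /A; ring.
  rewrite -[leRHS]mulr1 ler_wpM2l ?(ltW a0)//.
  by rewrite -[leRHS]mulr1 ler_pM ?sqr_ge0// exprn_ile1.
have g_part : g A * (2 * a * eta / r) `^ q * r ^+ 2 <= a / 2.
  have qq0 : 0 <= (2 * a * eta / r) `^ q * r ^+ 2 by rewrite mulr_ge0 ?powR_ge0// ltW.
  rewrite -mulrA; apply: le_trans (ler_wpM2r qq0 gA) _.
  have slopeE : 2 * a * eta / r = A * (2 / eta / r).
    by rewrite /A; field; rewrite !gt_eqF.
  have w0 : 0 <= 2 / eta by rewrite divr_ge0// ltW.
  have rE : r ^+ 2 = r `^ (2 - q) * r `^ q.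
    by rewrite -powRD ?(gt_eqF r0) ?implybT// subrK -powR_mulrn ?(ltW r0).
  have AE : A `^ (1 - q) * A `^ q = A.
    by rewrite -powRD ?(gt_eqF A0) ?implybT// subrK powRr1 ?(ltW A0).
  have -> : H `^ (2 - q) * A `^ (1 - q) * ((2 * a * eta / r) `^ q * r ^+ 2) =
      (H * r) `^ (2 - q) * (A * (2 / eta) `^ q).
    rewrite slopeE rE (powRM (2 - q) H0 (ltW r0)) powRM ?(ltW A0)//; last first.
      by rewrite divr_ge0// ltW.
    have -> : (2 / eta) `^ q = (2 / eta / r) `^ q * r `^ q.
      rewrite -powRM ?(ltW r0)//; last by rewrite divr_ge0// ltW.
      by rewrite divfK// gt_eqF.
    by rewrite -[in RHS]AE; ring.
  have Aw : A * (2 / eta) `^ q <= 4 * a.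
    apply: (@le_trans _ _ (A * (2 / eta) ^+ 2)); last first.
      by rewrite /A le_eqVlt; apply/orP; left; apply/eqP; field; rewrite gt_eqF.
    rewrite ler_wpM2l ?(ltW A0)// -powR_mulrn// ler_powR ?(ltW q2)//.
    by rewrite ler_pdivlMr// mul1r; lra.
  apply: (@le_trans _ _ (8^-1 * (4 * a))); last by lra.
  by rewrite ler_pM ?powR_ge0// mulr_ge0 ?powR_ge0// ltW.
by move: f_part g_part; set X := f A * _; set Y := g A * _ * _; lra.
Qed.

(** The supersolution lies above the barrier: the difference is zero at the
centre and nonnegative on the sphere of radius [r], and at an interior minimum
where it is negative the strict inequality for the barrier would be violated. At
distance [r / 2] the barrier equals [u y / 4]. *)
Lemma supersolution_local_harnack (R : realType) n (Omega : set 'rV[R]_n)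
    q f g u y (r H : R) :
  0 < q < 2 -> admissible f g ->
  {within Omega, continuous u} -> viscosity_supersolution Omega (rhs q f g) u ->
  (forall x, Omega x -> 0 <= u x) ->
  0 < r -> [set x | enorm (x - y) <= r] `<=` Omega ->
  (forall s, 0 < s <= u y -> hfun q f g s <= H) -> (H * r) `^ (2 - q) <= 8^-1 ->
  forall x, enorm (x - y) <= r / 2 -> u y <= 4 * u x.
Proof.
move=> q02 adm cu su u0 r0 BO hH Hr x xr2; have [hf hg] := admissible_homo adm.
have xr : enorm (x - y) <= r by lra.
have Oy : Omega y by apply: BO; rewrite /= subrr enorm0 ltW.
have [uy0|uy_gt0] := leP (u y) 0.
  by rewrite (le_trans uy0)// mulr_ge0// u0//; exact: BO.
set a := u y in uy_gt0 hH *.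
pose k := 2 * a / r ^+ 2.
have k0 : 0 < k by rewrite divr_gt0 ?exprn_gt0// mulr_gt0.
pose psi s := k / 2 * (s - r) ^+ 2.
have psi0 : psi 0 = a by rewrite /psi /k; field; rewrite gt_eqF.
have ballE z : (0 <= enorm (z - y) <= r) = (enorm (z - y) <= r).
  by rewrite enorm_ge0.
have KO : [set z | 0 <= enorm (z - y) <= r] `<=` Omega.
  by move=> z /=; rewrite ballE; exact: BO.
have cNu : {within Omega, continuous (fun z => - u z)}.
  by move=> z; apply: continuousN; exact: cu.
have yK : 0 <= enorm (y - y) <= r by rewrite subrr enorm0 lexx ltW.
have [x0] := @annulus_max R n Omega (fun z => - u z)
  (fun s => 0 + 0 * (s - r) + (- k) / 2 * (s - r) ^+ 2) y y 0 r cNu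
  (@quadratic_continuous R 0 r 0 (- k)) KO yK.
rewrite ballE => x0r max0.
have {max0} min0 z : enorm (z - y) <= r ->
    u x0 - psi (enorm (x0 - y)) <= u z - psi (enorm (z - y)).
  by move=> zr; have := max0 z; rewrite ballE zr => /(_ isT); rewrite /psi; lra.
have psi_r2 : forall s, s <= r / 2 -> a / 4 <= psi s.
  move=> s sr; have -> : a / 4 = k / 2 * (r / 2) ^+ 2.
    by rewrite /k; field; rewrite gt_eqF.
  have k2 : 0 <= k / 2 by rewrite divr_ge0// ltW.
  rewrite /psi ler_wpM2l// -[leRHS]sqrrN opprB.
  by rewrite ler_sqr ?nnegrE; lra.
suff w0 : 0 <= u x0 - psi (enorm (x0 - y)).
  by have := min0 x xr; have := psi_r2 _ xr2; lra.
rewrite leNgt; apply/negP; rewrite subr_lt0 => w0.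
have x0r' : enorm (x0 - y) < r.
  rewrite lt_neqAle x0r andbT; apply/negP => /eqP x0rE.
  move: w0; rewrite x0rE /psi subrr expr0n mulr0; apply/negP; rewrite -leNgt.
  by apply: u0; exact: BO.
have x00 : 0 < enorm (x0 - y).
  rewrite lt_neqAle enorm_ge0 andbT eq_sym; apply/negP => /eqP x00.
  have x0y : x0 = y by apply/eqP; rewrite -subr_eq0; apply/eqP/enorm_eq0.
  by move: w0; rewrite x0y subrr enorm0 psi0 -/a ltxx.
set r1 := enorm (x0 - y) in x0r' x00 w0 min0.
pose eta := (r - r1) / r.
have eta01 : 0 < eta <= 1.
  rewrite divr_gt0 ?subr_gt0//= ler_pdivrMr// mul1r.
  by rewrite gerBl ltW.
have psiE : psi r1 = a * eta ^+ 2 by rewrite /psi /k /eta; field; rewrite gt_eqF.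
pose m := - (2 * a * eta / r).
have m0 : 2 * a * eta / r > 0.
  case/andP: eta01 => e0 _; apply: divr_gt0 r0.
  by apply: mulr_gt0 e0; apply: mulr_gt0 uy_gt0.
have : k <= f (u x0) + g (u x0) * `|m| `^ q.
  apply: (@supersolution_radial _ _ _ _ _ _ _ y x0 m k su).
  - exact: BO.
  - exact: x00.
  - by rewrite oppr_eq0 gt_eqF.
  near=> z; have zr : enorm (z - y) <= r.
    by apply: ltW; near: z; exact: near_enorm_lt.
  have := min0 z zr; rewrite -/r1.
  (* [psi] is a parabola, so its second order expansion at [r1] is exact. *)
  suff -> : psi (enorm (z - y)) = psi r1 + m * (enorm (z - y) - r1)
     + k / 2 * (enorm (z - y) - r1) ^+ 2 by lra.
  by rewrite /psi /m /k /eta; field; rewrite gt_eqF.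
have psi1 : 0 < psi r1 <= a.
  case/andP: eta01 => e0 e1; rewrite psiE mulr_gt0 ?exprn_gt0//=.
  by rewrite ler_piMr ?(ltW uy_gt0)// exprn_ile1// ltW.
have := barrier_strict q02 adm uy_gt0 r0 eta01; rewrite -psiE => /(_ _ (hH _ psi1) Hr).
rewrite -/k => strict; apply/negP; rewrite -ltNge; apply: le_lt_trans strict.
rewrite normrN (gtr0_norm m0) lerD ?hf ?(ltW w0)//.
by rewrite ler_wpM2r ?powR_ge0// hg// ltW.
Unshelve. all: by end_near. Qed.

(** * Chains of balls and the distance to the boundary *)

Lemma thickening_open (R : realType) n (A : set 'rV[R]_n) (e : R) :
  open [set z | exists2 w, A w & ball w e z].
Proof.
have -> : [set z | exists2 w, A w & ball w e z] = \bigcup_(w in A) ball w e.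
  by apply/seteqP; split=> z /=; [move=> [w Aw wz]; exists w|move=> [w Aw wz]; exists w].
by apply: bigcup_open => w _; exact: ball_open.
Qed.

(** Steps of length zero are allowed, so [k] is an upper bound on the number of
steps. *)
Fixpoint chain (R : realType) n (O : set 'rV[R]_n) (step : R) (x : 'rV[R]_n)
    (k : nat) (z : 'rV[R]_n) : Prop :=
  if k is k'.+1 then O z /\ exists2 w, chain O step x k' w & enorm (z - w) <= step
  else z = x.

Section Chains.
Variables (R : realType) (n : nat) (O : set 'rV[R]_n) (step : R).
Hypotheses (step0 : 0 < step) (cO : connected O) (kO : compact (closure O)).

Lemma chain_in x k z : O x -> chain O step x k z -> O z.
Proof. by case: k => [Ox /= ->|k _ []]. Qed.

Lemma chainW x j k z : O x -> (j <= k)%N -> chain O step x j z -> chain O step x k z.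
Proof.
move=> Ox; elim: k => [|k IH]; first by rewrite leqn0 => /eqP ->.
rewrite leq_eqVlt => /predU1P[-> //|jk cz]; split; first exact: chain_in cz.
by exists z; [exact: IH|rewrite subrr enorm0 ltW].
Qed.

Let eps : R := step / (n.+1)%:R.
Let eps0 : 0 < eps. Proof. by rewrite divr_gt0. Qed.

Let enorm_eps (z : 'rV[R]_n) : `|z| <= eps -> enorm z <= step.
Proof.
move=> ze; rewrite (le_trans (enorm_le_normr z))//.
apply: (@le_trans _ _ (n.+1%:R * eps)); last first.
  by rewrite /eps mulrC divfK.
by rewrite ler_pM// ler_nat.
Qed.

(** The set of reachable points and its complement in [O] are both unions of
traces of balls of radius [eps], so the former is relatively open and closed. *)
Lemma chain_exists x z : O x -> O z -> exists k, chain O step x k z.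
Proof.
move=> Ox Oz; pose B := [set z | exists k, chain O step x k z].
have BO z' : B z' -> O z' by move=> [k /chain_in]; apply.
have Bnext w z' : B w -> O z' -> enorm (z' - w) <= step -> B z'.
  by move=> [k cw] Oz' zw; exists k.+1; split => //; exists w.
have ballP (w z' : 'rV[R]_n) : ball w eps z' -> enorm (z' - w) <= step.
  rewrite mx_norm_ball /ball_ /= => zw.
  by apply: enorm_eps; rewrite distrC ltW.
suff BE : B = O by have := Oz; rewrite -[X in X _ -> _]BE.
apply: cO; first by exists x, 0%N.
- exists [set z' | exists2 w, B w & ball w eps z']; first exact: thickening_open.
  apply/seteqP; split=> z' /=.
    by move=> Bz; split; [exact: BO|exists z' => //; exact: ballxx].
  by move=> [Oz' [w Bw wz]]; apply: Bnext Bw Oz' _; exact: ballP.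
- exists (~` [set z' | exists2 w, (O `\` B) w & ball w eps z']).
    by apply: open_closedC; exact: thickening_open.
  apply/seteqP; split=> z' /=.
    move=> Bz; split; [exact: BO|move=> [w [Ow nBw] wz]; apply: nBw].
    apply: Bnext Bz Ow _; apply: ballP; exact: ball_sym.
  move=> [Oz' nz]; apply: contrapT => nB; apply: nz; exists z' => //.
  exact: ballxx.
Qed.

(** The step count bounds nearby points up to one more step, hence is locally
bounded at every point of the compact closure of [O]. *)
Lemma chain_uniform x : O x -> exists N, forall z, O z -> chain O step x N z.
Proof.
move=> Ox; have ncO := (compact_near_coveringP _).1 kO.
have [|N _ HN] := ncO nat \oo (fun k z => O z -> chain O step x k z) _ _; last first.
  exists N => z Oz; apply: (HN N (leqnn N)) => //.
  exact: subset_closure.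
move=> z clz; have e2 : 0 < eps / 2 by rewrite divr_gt0.
have [w [Ow zw]] := clz (ball z (eps / 2)) (nbhsx_ballx _ _ e2).
have [k cw] := chain_exists Ox Ow.
exists (ball z (eps / 2), [set i | (k < i)%N]).
  by split=> /=; [exact: nbhsx_ballx|exists k.+1].
move=> [z' i] /= [zz' ki] Oz'; apply: (chainW Ox ki); split => //; exists w => //.
apply: enorm_eps; move: zz' zw; rewrite !mx_norm_ball /ball_ /= => zz' zw.
have -> : z' - w = - (z - z') + (z - w) by rewrite opprB addrA subrK.
by rewrite (le_trans (ler_normD _ _))// normrN; lra.
Qed.

Lemma harnack_chain : exists N, forall u : 'rV[R]_n -> R,
  (forall x, O x -> 0 <= u x) ->
  (forall x y, O x -> O y -> enorm (x - y) <= step -> u y <= 4 * u x) ->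
  forall x y, O x -> O y -> u y <= 4 ^+ N * u x.
Proof.
have [[x1 Ox1]|noO] := pselect (O !=set0); last first.
  by exists 0%N => u _ _ x y Ox; case: noO; exists x.
have [N HN] := chain_uniform Ox1; exists (N + N)%N => u u0 H x y Ox Oy.
have sym (a b : 'rV[R]_n) : enorm (a - b) = enorm (b - a).
  by rewrite -opprB -scaleN1r enormZ normrN1 mul1r.
have both k z : chain O step x1 k z -> u z <= 4 ^+ k * u x1 /\ u x1 <= 4 ^+ k * u z.
  elim: k z => [|k IH] z; first by move=> ->; rewrite expr0 mul1r.
  move=> [Oz [w cw zw]]; have Ow := chain_in Ox1 cw; have [h1 h2] := IH w cw.
  have p4 : 0 <= 4 ^+ k :> R by rewrite exprn_ge0.
  split.
    rewrite exprS -mulrA (le_trans (H w z Ow Oz _))//; first by rewrite sym.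
    by rewrite ler_wpM2l.
  rewrite exprSr -mulrA (le_trans h2)// ler_wpM2l//.
  exact: H.
have [h1 _] := both N y (HN y Oy); have [_ h2] := both N x (HN x Ox).
rewrite exprD -mulrA (le_trans h1)// ler_wpM2l// exprn_ge0//.
Qed.

End Chains.

Section Domain.
Variables (R : realType) (n : nat) (Omega : set 'rV[R]_n).
Hypothesis oOmega : open Omega.

(** The points of a segment that lie in [Omega] form a relatively open set, which
is also relatively closed as long as the segment does not meet the boundary. *)
Lemma ball_subset_domain y r : Omega y ->
  (forall z, boundary Omega z -> r < enorm (y - z)) ->
  [set x | enorm (x - y) <= r] `<=` Omega.
Proof.
move=> Oy far x /= xr.
pose gam (s : R) : 'rV[R]_n := y + s *: (x - y).
have cgam : continuous gam.
  by move=> s; apply: cvgD; [exact: cvg_cst|exact: scalel_continuous].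
have inK s : 0 <= s <= 1 -> ~ boundary Omega (gam s).
  move=> /andP[s0 s1] /far; apply/negP; rewrite -leNgt.
  rewrite /gam opprD addrA subrr sub0r -scaleNr enormZ normrN (ger0_norm s0).
  by rewrite (le_trans _ xr)// ler_piMl// enorm_ge0.
suff E : `[0, 1] `&` gam @^-1` Omega = `[0, 1]%classic.
  have : (`[0, 1]%classic : set R) 1 by rewrite /= in_itv /= ler01 lexx.
  by rewrite -E => -[_ /=]; rewrite /gam scale1r addrC subrK.
apply: segment_connected.
- by exists 0; split; rewrite /= ?in_itv /= ?lexx ?ler01// /gam scale0r addr0.
- exists (gam @^-1` Omega) => //; apply: open_comp => // s _; exact: cgam.
- exists (gam @^-1` closure Omega).
    by apply: closed_comp; [move=> s _; exact: cgam|exact: closed_closure].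
  apply/seteqP; split=> s /= [s01 Os]; split => //; first exact: subset_closure.
  apply: contrapT => nO; apply: (@inK s); first by move: s01; rewrite in_itv.
  by split => //; rewrite (interior_id _).1.
Qed.

(** Near each point of the compact closure some distance to the boundary is kept;
compactness makes it uniform. *)
Lemma compactly_contained_dist (O : set 'rV[R]_n) : compactly_contained O Omega ->
  exists2 e, 0 < e & forall x z, O x -> boundary Omega z -> e <= enorm (x - z).
Proof.
move=> [kO OOm]; have ncO := (compact_near_coveringP _).1 kO.
have nOm z : boundary Omega z -> ~ Omega z.
  by move=> [_]; rewrite (interior_id _).1.
have : \forall e \near 0^'+, closure O `<=`
    (fun x => forall z, boundary Omega z -> e <= enorm (x - z)).
  apply: ncO => x /OOm Ox.
  have /nbhs_ballP[e /= e0 be] : nbhs x Omega by exact: open_nbhs_nbhs.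
  exists (ball x (e / 2), [set s | s < e / 2]).
    split=> /=; first by apply: nbhsx_ballx; rewrite divr_gt0.
    by apply: nbhs_right_lt; rewrite divr_gt0.
  move=> [x' s] /= [xx' se] z bz; rewrite leNgt; apply/negP => xz.
  apply: (nOm z bz); apply: be; move: xx'; rewrite !mx_norm_ball /ball_ /= => xx'.
  have -> : x - z = (x - x') + (x' - z) by rewrite addrA subrK.
  have := normr_le_enorm (x' - z); have := ler_normD (x - x') (x' - z); lra.
move=> nE; near (0 : R)^'+ => e; exists e => // x z Ox.
have eP : closure O `<=` (fun x => forall z, boundary Omega z -> e <= enorm (x - z)).
  by near: e.
exact: (eP x (subset_closure Ox) z).
Unshelve. all: by end_near. Qed.

End Domain.

(** * The Harnack inequality *)

Lemma ereal_sup_le_inf (R : realType) T (O : set T) (u : T -> R) (C : R) :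
  0 < C -> (forall x y, O x -> O y -> u y <= C * u x) ->
  (ereal_sup [set (u x)%:E | x in O] <= C%:E * ereal_inf [set (u x)%:E | x in O])%E.
Proof.
move=> C0 uC; apply: ge_ereal_sup => _ [y Oy <-].
rewrite -lee_pdivrMl//; apply: le_ereal_inf_tmp => _ [x Ox <-].
by rewrite -EFinM lee_fin ler_pdivrMl// uC.
Qed.

Lemma set_dist_le (R : realType) n (A B : set 'rV[R]_n) x z :
  A x -> B z -> set_dist A B <= enorm (x - z).
Proof.
move=> Ax Bz; apply: ge_inf; last by exists x => //; exists z.
by exists 0 => _ [a _ [b _ <-]]; exact: enorm_ge0.
Qed.

Lemma set_dist_gt0 (R : realType) n (O Omega : set 'rV[R]_n) :
  open Omega -> O !=set0 -> boundary Omega !=set0 ->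
  compactly_contained O Omega -> 0 < set_dist O (boundary Omega).
Proof.
move=> oO [x Ox] [z bz] cc.
have [e e0 eP] := compactly_contained_dist oO cc.
apply: (lt_le_trans e0); apply: lb_le_inf; first by exists (enorm (x - z)), x => //; exists z.
by move=> _ [a Oa [b bb <-]]; exact: eP.
Qed.

(** The common core of the two parts. The bound [H] fixes the scale [r] on which
the local inequality holds, so the number of steps in a chain joining two points
of [O], and with it [C], depends on [q], [d], [H] and [O] only. *)
Lemma harnack_of_hfun_bound (R : realType) n (q d H : R) (O : set 'rV[R]_n) :
  0 < q < 2 -> 0 < d -> 0 < H -> connected O ->
  exists2 C : R, 0 < C & forall (Omega : set 'rV[R]_n) (f g : R -> R) u,
    open Omega -> compactly_contained O Omega ->
    set_dist O (boundary Omega) = d -> admissible f g ->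
    viscosity_solution Omega (rhs q f g) u -> (forall x, Omega x -> 0 <= u x) ->
    (forall y s, O y -> [set x | enorm (x - y) <= d / 2] `<=` Omega ->
       0 < s <= u y -> hfun q f g s <= H) ->
    (ereal_sup [set (u x)%:E | x in O] <= C%:E * ereal_inf [set (u x)%:E | x in O])%E.
Proof.
move=> q02 d0 H0 cO; have /andP[q0 q2] := q02.
have p2 : 0 < 2 - q by rewrite subr_gt0.
have [kO|nkO] := pselect (compact (closure O)); last first.
  by exists 1 => // Omega f g u _ [].
pose c : R := 8^-1 `^ (2 - q)^-1; have c0 : 0 < c by rewrite powR_gt0.
pose r := Num.min (d / 2) (c / H).
have r0 : 0 < r by rewrite lt_min !divr_gt0.
have Hr : (H * r) `^ (2 - q) <= 8^-1.
  have -> : 8^-1 = c `^ (2 - q) by rewrite -powRrM mulVf ?gt_eqF// powRr1.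
  rewrite ge0_ler_powR ?nnegrE ?(ltW p2) ?(ltW c0)//.
    by rewrite mulr_ge0 ?ltW.
  by rewrite mulrC -ler_pdivlMr// ge_min lexx orbT.
have r20 : 0 < r / 2 by rewrite divr_gt0.
have [N HN] := harnack_chain r20 cO kO.
exists (4 ^+ N); first by rewrite exprn_gt0.
move=> Omega f g u oOm [_ OOm] dE adm [cu _ su] u0 hH.
have OO x : O x -> Omega x by move=> Ox; apply: OOm; exact: subset_closure.
have ballO y : O y -> [set x | enorm (x - y) <= d / 2] `<=` Omega.
  move=> Oy; apply: ball_subset_domain => //; first exact: OO.
  move=> z bz; apply: (@lt_le_trans _ _ d); first by lra.
  by rewrite -dE; exact: set_dist_le.
apply: ereal_sup_le_inf; first by rewrite exprn_gt0.
apply: HN => [x Ox|x y Ox Oy xy]; first by apply: u0; exact: OO.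
apply: (@supersolution_local_harnack R n Omega q f g u y r H) => //.
- move=> z /= zr; apply: (ballO y Oy); rewrite /= (le_trans zr)//.
  by rewrite ge_min lexx.
- by move=> s suy; exact: hH (ballO y Oy) suy.
Qed.

Theorem theorem2p2 (R : realType) (n : nat) :
  (forall (q nu rho : R) (O : set 'rV[R]_n) (d : R),
     0 < q < 1 -> 0 < rho < 1 -> 0 < nu ->
     open O -> connected O ->
     exists2 C : R, 0 < C &
       forall (Omega : set 'rV[R]_n) (f g : R -> R),
         open Omega -> boundary Omega !=set0 ->
         compactly_contained O Omega ->
         set_dist O (boundary Omega) = d ->
         admissible f g ->
         (forall s t : R, 0 < t -> t <= s ->
            rho * (hfun q f g t / t `^ nu) <= hfun q f g s / s `^ nu) ->
         forall u : 'rV[R]_n -> R,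
           viscosity_solution Omega (rhs q f g) u ->
           (forall x, Omega x -> 0 <= u x) ->
           (ereal_sup [set (u x)%:E | x in O]
            <= C%:E * ereal_inf [set (u x)%:E | x in O])%E)
  /\
  (forall (q mu : R) (f g : R -> R) (O : set 'rV[R]_n) (d : R),
     1 <= q < 2 -> 0 < mu < 1 ->
     admissible f g ->
     (forall s t : R, 0 < t -> t <= s -> mu * hfun q f g t <= hfun q f g s) ->
     integral_condition q f g ->
     (1 < q ->
        f t @[t --> +oo] --> +oo \/ g t @[t --> +oo] --> +oo) ->
     open O -> connected O ->
     exists2 C : R, 0 < C &
       forall Omega : set 'rV[R]_n,
         open Omega -> boundary Omega !=set0 ->
         compactly_contained O Omega ->
         set_dist O (boundary Omega) = d ->
         forall u : 'rV[R]_n -> R,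
           viscosity_solution Omega (rhs q f g) u ->
           (forall x, Omega x -> 0 <= u x) ->
           (ereal_sup [set (u x)%:E | x in O]
            <= C%:E * ereal_inf [set (u x)%:E | x in O])%E).
Proof.
(* [C] is chosen before the domain; without [0 < d] only [O = set0] remains. *)
have trivial_case (O : set 'rV[R]_n) d : ~ 0 < d ->
    forall Omega : set 'rV[R]_n, open Omega -> boundary Omega !=set0 ->
    compactly_contained O Omega -> set_dist O (boundary Omega) = d ->
    forall u : 'rV[R]_n -> R, (ereal_sup [set (u x)%:E | x in O]
      <= 1%:E * ereal_inf [set (u x)%:E | x in O])%E.
  move=> d0 Omega oOm bOm cc dE u; apply: ereal_sup_le_inf => // x y Ox _.
  by case: d0; rewrite -dE; apply: set_dist_gt0 => //; exists x.
split.
  move=> q nu rho O d q01 rho01 nu0 _ cO; have /andP[rho0 _] := rho01.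
  have [d0|d0] := pselect (0 < d); last first.
    exists 1 => // Omega f g oOm bOm cc dE _ _ u _ _.
    exact: trivial_case d0 _ oOm bOm cc dE _.
  have q02 : 0 < q < 2 by case/andP: q01 => -> q1; lra.
  have d2 : 0 < d / 2 by rewrite divr_gt0.
  pose H := `|power_radius_const q nu rho| / (d / 2) / rho + 1.
  have H0 : 0 < H by rewrite ltr_wpDl// !divr_ge0// ltW.
  have [C C0 HC] := harnack_of_hfun_bound q02 d0 H0 cO.
  exists C => // Omega f g oOm _ cc dE adm hyp u vs u0.
  apply: (HC Omega f g u) => // y s Oy BO /andP[s0 su].
  have uy0 : 0 < u y := lt_le_trans s0 su.
  have [cu sub _] := vs.
  have := @subsolution_radius_power R n Omega q nu rho f g u y (d / 2)
    q01 nu0 rho01 adm hyp cu sub d2 BO uy0.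
  rewrite mulrC -ler_pdivlMr// => hu.
  have hs := hfun_gt0 q adm s0; have sn := powR_gt0 nu s0.
  have un := powR_gt0 nu uy0; have huy := hfun_gt0 q adm uy0.
  have hle : rho * hfun q f g s <= hfun q f g (u y).
    have := hyp (u y) s s0 su; rewrite mulrA (ler_pdivrMr _ _ sn).
    move=> /le_trans; apply.
    rewrite -[leRHS]mulr1 -mulrA ler_wpM2l ?(ltW huy)//.
    rewrite mulrC ler_pdivrMr// mul1r.
    apply: ge0_ler_powR su; first exact: ltW.
      by rewrite nnegrE ltW.
    by rewrite nnegrE ltW.
  rewrite /H; apply: (@le_trans _ _ (`|power_radius_const q nu rho| / (d / 2) / rho)).
    rewrite ler_pdivlMr// mulrC (le_trans hle)// (le_trans hu)//.
    by rewrite ler_wpM2r ?invr_ge0 ?(ltW d2)// ler_norm.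
  by rewrite lerDl.
move=> q mu f g O d q12 mu01 adm hyp ic lim _ cO; have /andP[mu0 _] := mu01.
have /andP[q1 q2] := q12.
have q02 : 0 < q < 2 by rewrite q2 (lt_le_trans ltr01).
have [d0|d0] := pselect (0 < d); last first.
  exists 1 => // Omega oOm bOm cc dE u _ _.
  exact: trivial_case d0 _ oOm bOm cc dE _.
have unb : unbounded_above f \/ unbounded_above g.
  move: q1; rewrite le_eqVlt => /predU1P[q1|/lim].
    by apply: integral_condition_unbounded adm _; rewrite q1.
  by case=> /cvgy_unbounded; [left|right].
have d2 : 0 < d / 2 by rewrite divr_gt0.
have [T T0 HT] := subsolution_bound q02 adm unb ic d2.
pose H := hfun q f g T / mu.
have H0 : 0 < H by rewrite divr_gt0// hfun_gt0.
have [C C0 HC] := harnack_of_hfun_bound q02 d0 H0 cO.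
exists C => // Omega oOm _ cc dE u vs u0.
apply: (HC Omega f g u) => // y s Oy BO /andP[s0 su].
have [cu sub _] := vs.
have uT := HT n Omega u y cu sub BO.
rewrite /H ler_pdivlMr// mulrC; apply: hyp => //; exact: le_trans uT.
Qed.
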